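(* The following problem ($\mathsf{MC}\sqsubseteq\mathsf{MDP}$) is undecidable: given a labelled Markov chain $\mathcal{C}$ and a labelled Markov decision process $\mathcal{D}$ over the same finite label set $L$ (with rational probabilities), decide whether $\mathcal{C}\sqsubseteq\mathcal{D}$, i.e. whether there exists a strategy $\beta$ of $\mathcal{D}$ such that $\mathit{Tr}_{\mathcal{C}}=\mathit{Tr}_{\mathcal{D},\beta}$.
   Context: A labelled Markov decision process (MDP) is a tuple $\mathcal{D}=\langle Q,\mu_0,L,\delta\rangle$ where $Q$ is a finite set of states, $\mu_0$ is a probability distribution on $Q$ (the initial distribution), $L$ is a finite set of labels, and $\delta$ assigns to each state $q$ a finite nonempty set $\mathsf{moves}(q)$ of moves, each move $\mathsf{m}$ being a probability distribution over $L\times Q$ (written $\mathsf{m}(a,q')$). A path is a finite sequence $\rho=q_0a_1q_1\cdots a_nq_n$ with $q_i\in Q$, $a_i\in L$; its trace is $a_1\cdots a_n$ and $\mathsf{last}(\rho)=q_n$. A strategy $\alpha$ maps every path $\rho$ to a probability distribution $\alpha(\rho)$ on $\mathsf{moves}(\mathsf{last}(\rho))$. The probability of paths is defined by $\Pr_{\mathcal{D},\alpha}(q_0)=\mu_0(q_0)$ and $\Pr_{\mathcal{D},\alpha}(\rho\, a\, q)=\Pr_{\mathcal{D},\alpha}(\rho)\sum_{\mathsf{m}\in\mathsf{moves}(\mathsf{last}(\rho))}\alpha(\rho)(\mathsf{m})\,\mathsf{m}(a,q)$. The trace-probability function is $\mathit{Tr}_{\mathcal{D},\alpha}:L^*\to[0,1]$,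 $\mathit{Tr}_{\mathcal{D},\alpha}(w)=\sum_{\rho:\,\text{trace}(\rho)=w}\Pr_{\mathcal{D},\alpha}(\rho)$. A labelled Markov chain (MC) is an MDP in which every state has exactly one move; its trace-probability function does not depend on the strategy and is written $\mathit{Tr}_{\mathcal{C}}$. For MDPs $\mathcal{D},\mathcal{E}$ over the same labels, $\mathcal{D}\sqsubseteq\mathcal{E}$ (trace refinement) means: for every strategy $\alpha$ of $\mathcal{D}$ there is a strategy $\beta$ of $\mathcal{E}$ with $\mathit{Tr}_{\mathcal{D},\alpha}=\mathit{Tr}_{\mathcal{E},\beta}$. *)

(* Defs.v *)
From HB Require Import structures.
From mathcomp Require Import all_boot all_order all_algebra.
From mathcomp Require Import reals.

Set Implicit Arguments.
Unset Strict Implicit.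
Unset Printing Implicit Defensive.

Import Order.TTheory GRing.Theory Num.Theory.
Local Open Scope ring_scope.

Definition is_distr (K : numDomainType) (T : finType) (p : T -> K) : Prop :=
  (forall x, 0 <= p x) /\ \sum_x p x = 1.

(* The finite nonempty set of moves of a state is given as a duplicate-free
   list.  Transition probabilities are rational, so that an MDP is a finite
   object; strategies (below) range over arbitrary real distributions. *)
Record mdp (L Q : finType) := Mdp {
  init : {ffun Q -> rat};
  moves : Q -> seq {ffun L * Q -> rat};
  init_distr : is_distr init;
  moves_distr : forall q m, m \in moves q -> is_distr m;
  moves_uniq : forall q, uniq (moves q);
  moves_nonempty : forall q, moves q != [::]
}.

Definition is_mc (L Q : finType) (D : mdp L Q) : Prop :=
  forall q, size (moves D q) = 1%N.

(* The path q0 a1 q1 ... an qn is (q0, [:: (an, qn); ...; (a1, q1)]):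
   the most recent step comes first. *)
Definition mdp_path (L Q : finType) : Type := (Q * seq (L * Q))%type.

Section Paths.
Variables L Q : finType.

Definition last_state (rho : mdp_path L Q) : Q :=
  if rho.2 is (_, q) :: _ then q else rho.1.

Definition trace (rho : mdp_path L Q) : seq L := rev (unzip1 rho.2).

End Paths.

Section Semantics.
Variables (R : realType) (L Q : finType) (D : mdp L Q).

(* [alpha rho m] is the probability given to the move [m] after [rho]; its
   values at m \notin moves D (last_state rho) are irrelevant. *)
Definition is_strategy
    (alpha : mdp_path L Q -> {ffun L * Q -> rat} -> R) : Prop :=
  forall rho,
    (forall m, m \in moves D (last_state rho) -> 0 <= alpha rho m) /\
    \sum_(m <- moves D (last_state rho)) alpha rho m = 1.

Variable alpha : mdp_path L Q -> {ffun L * Q -> rat} -> R.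

Fixpoint path_prob_rec (q0 : Q) (h : seq (L * Q)) : R :=
  if h is (a, q) :: h' then
    path_prob_rec q0 h' *
      \sum_(m <- moves D (last_state (q0, h'))) alpha (q0, h') m * ratr (m (a, q))
  else ratr (init D q0).

Definition path_prob (rho : mdp_path L Q) : R := path_prob_rec rho.1 rho.2.

(* A path with trace w has exactly [size w] steps, so this finite sum ranges
   over all paths with trace w. *)
Definition trace_prob (w : seq L) : R :=
  \sum_(q0 : Q)
    \sum_(h : (size w).-tuple (L * Q) | trace (q0, tval h) == w)
      path_prob (q0, tval h).

End Semantics.

Definition trace_refines (R : realType) (L Q1 Q2 : finType)
    (D : mdp L Q1) (E : mdp L Q2) : Prop :=
  forall alpha : mdp_path L Q1 -> {ffun L * Q1 -> rat} -> R,
    is_strategy D alpha ->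
    exists2 beta : mdp_path L Q2 -> {ffun L * Q2 -> rat} -> R,
      is_strategy E beta & trace_prob D alpha =1 trace_prob E beta.

(* Kleene's partial recursive functions of arity n.  In [RPrec f g] and
   [RMu f] the recursion (resp. minimisation) variable is the first argument. *)
Inductive recfun : nat -> Type :=
| RZero n : recfun n
| RSucc : recfun 1%N
| RProj n (i : 'I_n) : recfun n
| RComp n k (f : recfun k) (g : 'I_k -> recfun n) : recfun n
| RPrec n (f : recfun n) (g : recfun n.+2) : recfun n.+1
| RMu n (f : recfun n.+1) : recfun n.

(* [computes f v y]: f is defined at v, with value y. *)
Fixpoint computes n (f : recfun n) : n.-tuple nat -> nat -> Prop :=
  match f in recfun n return n.-tuple nat -> nat -> Prop with
  | RZero _ => fun _ y => y = 0%N
  | RSucc => fun v y => y = (thead v).+1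
  | RProj _ i => fun v y => y = tnth v i
  | RComp n k f g => fun v y =>
      exists2 u : k.-tuple nat,
        forall i, computes (g i) v (tnth u i) & computes f u y
  | RPrec n f g => fun v =>
      let x := [tuple of behead v] in
      (fix prec (t : nat) (y : nat) : Prop :=
         if t is t'.+1 then
           exists2 z, prec t' z & computes g [tuple of t' :: z :: x] y
         else computes f x y) (thead v)
  | RMu n f => fun v y =>
      computes f [tuple of y :: v] 0%N /\
      forall t, (t < y)%N -> exists z, computes f [tuple of t :: v] z.+1
  end.

(* [P] is decided, on instances presented by their code number, by a partial
   recursive function that terminates on every code (nothing is required on
   numbers that are not codes). *)
Definition recursively_decidable (I : Type) (code : I -> nat) (P : I -> Prop) :
    Prop :=
  exists f : recfun 1%N, forall x : I,
    (P x -> computes f [tuple code x] 1%N) /\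
    (~ P x -> computes f [tuple code x] 0%N).

(* Up to renaming, states and labels are 0, ..., n-1. *)
Record instance := Instance {
  nlabels : nat;
  nstatesC : nat;
  nstatesD : nat;
  inst_C : mdp 'I_nlabels 'I_nstatesC;
  inst_D : mdp 'I_nlabels 'I_nstatesD;
  inst_mc : is_mc inst_C
}.

Definition MC_refines_MDP (R : realType) (x : instance) : Prop :=
  trace_refines R (inst_C x) (inst_D x).

(* Nested lists of numbers are coded through the (primitive recursive)
   bijection [CodeSeq.code : seq nat -> nat].  All rationals involved are
   nonnegative, so the sign of the numerator is not recorded. *)
Definition code_rat (r : rat) : nat :=
  CodeSeq.code [:: `|numq r|%N; `|denq r|%N].

Section Codes.
Variables k n : nat.

Definition code_init (p : {ffun 'I_n -> rat}) : nat :=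
  CodeSeq.code [seq code_rat (p q) | q <- enum 'I_n].

Definition code_move (m : {ffun 'I_k * 'I_n -> rat}) : nat :=
  CodeSeq.code
    [seq CodeSeq.code [seq code_rat (m (a, q)) | q <- enum 'I_n] | a <- enum 'I_k].

Definition code_mdp (D : mdp 'I_k 'I_n) : nat :=
  CodeSeq.code
    [:: code_init (init D);
        CodeSeq.code
          [seq CodeSeq.code [seq code_move m | m <- moves D q] | q <- enum 'I_n]].

End Codes.

Definition code_instance (x : instance) : nat :=
  CodeSeq.code
    [:: nlabels x; nstatesC x; nstatesD x; code_mdp (inst_C x); code_mdp (inst_D x)].

(* Main.v *)
Require Import Defs.
From HB Require Import structures.
From mathcomp Require Import all_boot all_order all_algebra.
From mathcomp Require Import reals.
From mathcomp Require Import ring lra zify.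

(* A nondeterministic program over counters is turned into an instance which is
   positive iff the program has no successful run.

   The Markov chain outputs uniformly random labels.  The MDP does the same while
   it maintains, along the word read so far (a path in the control graph of the
   program), probabilities proportional to 2^(x_i - x_j) for all counters x_i, x_j:
   increments and copies act linearly on them.  A test x_i = x_j adds
   2^(x_i - x_j) + 2^(x_j - x_i) to an accumulator; this is 2 if the test is passed
   and at least 5/2 otherwise, so that comparing the accumulator with a weight that
   counts the tests tells whether all tests were passed.  The comparison V <= U of
   two weights is imposed by the two labels lx, ly: states of V must output ly
   where states of U may choose between lx and ly, and the strategy can match the
   Markov chain exactly when V <= U after every word.

   For undecidability no universal machine is needed: a number n can be placed in
   the initial distribution of the MDP (with weights 1, 2^n, 2^-n), and the code of
   the instance is a computable function of n and of the code of all the rest.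
   Given a decision procedure f, the program recovers from n the code of the rest
   of an instance, computes the code of the instance obtained by placing n in it
   and succeeds iff f answers 1.  When n codes the rest of the very instance built
   from this program, f is wrong on that instance. *)

Set Implicit Arguments.
Unset Strict Implicit.
Unset Printing Implicit Defensive.

Import Order.TTheory GRing.Theory Num.Theory.
Local Open Scope ring_scope.

(** * Comparing two weights by a refinement *)

Section Expectation.
Variables (R : realType) (L Q : finType) (D : mdp L Q).
Variable alpha : mdp_path L Q -> {ffun L * Q -> rat} -> R.

Definition step_prob (rho : mdp_path L Q) (l : L) (q : Q) : R :=
  \sum_(m <- moves D (last_state rho)) alpha rho m * ratr (m (l, q)).

(* [expect rw G] sums [Pr(rho) * G rho] over the paths rho whose trace is the
   reversal of [rw]. *)
Fixpoint expect (rw : seq L) (G : mdp_path L Q -> R) : R :=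
  if rw is l :: rw' then
    expect rw' (fun rho => \sum_q step_prob rho l q * G (rho.1, (l, q) :: rho.2))
  else \sum_q ratr (init D q) * G (q, [::]).

Lemma sum_tuple_cons n (l : L) (rw : seq L) (F : seq (L * Q) -> R) :
  \sum_(h : n.+1.-tuple (L * Q) | unzip1 h == l :: rw) F h =
  \sum_(h : n.-tuple (L * Q) | unzip1 h == rw) \sum_q F ((l, q) :: h).
Proof.
pose c (x : (L * Q) * n.-tuple (L * Q)) := [tuple of x.1 :: x.2].
have c_bij : bijective c.
  exists (fun t => (thead t, [tuple of behead t])).
    by case=> x t; congr pair; apply: val_inj.
  by move=> t; rewrite /c /= -tuple_eta.
rewrite (reindex c) /=; last exact: onW_bij.
transitivity (\sum_(x : (L * Q) * n.-tuple (L * Q) |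
    (x.1.1 == l) && (unzip1 x.2 == rw)) F (x.1 :: x.2)).
  by apply: eq_bigl => x; rewrite eqseq_cons.
rewrite -(pair_big (fun x => x.1 == l) (fun h : n.-tuple _ => unzip1 h == rw)
            (fun x (h : n.-tuple _) => F (x :: h))) /=.
rewrite exchange_big /=; apply: eq_bigr => h _.
transitivity (\sum_(x : L * Q | (x.1 == l) && true) F ((x.1, x.2) :: h)).
  by apply: eq_big => [x|[]]; rewrite ?andbT.
by rewrite -(pair_big (pred1 l) xpredT (fun l' q => F ((l', q) :: h))) big_pred1_eq.
Qed.

(** Histories list the most recent step first, as [rw] does, so both are peeled from the head. The
    recursion serves inductions on words, the sum serves linearity and monotonicity. *)
Lemma expectE n (rw : seq L) (G : mdp_path L Q -> R) : size rw = n ->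
  expect rw G = \sum_q \sum_(h : n.-tuple (L * Q) | unzip1 h == rw)
                  path_prob D alpha (q, tval h) * G (q, tval h).
Proof.
elim: rw n G => [|l rw IH] [|n] G //= => [_|[sz]].
  apply: eq_bigr => q _; rewrite (big_pred1 [tuple]) // => t.
  by rewrite (tuple0 t) /=; apply/esym/eqP.
rewrite (IH _ _ sz); apply: eq_bigr => q _.
rewrite (sum_tuple_cons n l rw (fun h => path_prob D alpha (q, h) * G (q, h))).
apply: eq_bigr => h _; rewrite mulr_sumr; apply: eq_bigr => q' _.
by rewrite mulrA.
Qed.

Lemma trace_probE (w : seq L) : trace_prob D alpha w = expect (rev w) (fun _ => 1).
Proof.
rewrite (expectE _ (size_rev w)); apply: eq_bigr => q _.
apply: eq_big => [h|h _]; last by rewrite mulr1.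
by rewrite /trace /= -(inj_eq (can_inj revK)) revK.
Qed.

Lemma eq_expect rw (G G' : mdp_path L Q -> R) :
  (forall rho, unzip1 rho.2 = rw -> G rho = G' rho) -> expect rw G = expect rw G'.
Proof.
move=> eqG; rewrite !(expectE _ (erefl _)); apply: eq_bigr => q _.
by apply: eq_bigr => h /eqP hw; rewrite eqG.
Qed.

Lemma expectZ rw (c : R) G : expect rw (fun rho => c * G rho) = c * expect rw G.
Proof.
rewrite !(expectE _ (erefl _)) mulr_sumr; apply: eq_bigr => q _.
by rewrite mulr_sumr; apply: eq_bigr => h _; rewrite mulrCA.
Qed.

Lemma expectD rw G G' :
  expect rw (fun rho => G rho + G' rho) = expect rw G + expect rw G'.
Proof.
rewrite !(expectE _ (erefl _)) -big_split; apply: eq_bigr => q _ /=.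
by rewrite -big_split; apply: eq_bigr => h _; rewrite mulrDr.
Qed.

Hypothesis alphaP : is_strategy D alpha.

Lemma path_prob_ge0 rho : 0 <= path_prob D alpha rho.
Proof.
case: rho => q h; rewrite /path_prob /=; elim: h => [|[l q'] h IH] /=.
  by rewrite ler0q; case: (init_distr D).
rewrite mulr_ge0 //; rewrite big_seq sumr_ge0 // => m mP.
rewrite mulr_ge0 //; first by case: (alphaP (q, h)) => + _; apply.
by rewrite ler0q; case: (moves_distr mP).
Qed.

Lemma le_expect rw G G' : (forall rho, G rho <= G' rho) ->
  expect rw G <= expect rw G'.
Proof.
move=> leG; rewrite !(expectE _ (erefl _)) ler_sum // => q _.
by rewrite ler_sum // => h _; rewrite ler_wpM2l // path_prob_ge0.
Qed.

End Expectation.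

(** * The Markov chain with uniformly random labels *)

Section Uniform.
Variables (L : finType) (l0 : L).

Definition uniform_move : {ffun L * 'I_1 -> rat} := [ffun => #|L|%:R^-1].

Lemma card_labels_gt0 : (0 < #|L|)%N.
Proof. by apply/card_gt0P; exists l0. Qed.

Lemma uniform_init_distr : is_distr [ffun _ : 'I_1 => 1 : rat].
Proof. by split=> [q|]; rewrite ?big_ord1 ffunE. Qed.

Lemma uniform_move_distr (q : 'I_1) m : m \in [:: uniform_move] -> is_distr m.
Proof.
rewrite inE => /eqP ->; split=> [x|]; first by rewrite ffunE invr_ge0 ler0n.
under eq_bigr do rewrite ffunE.
rewrite sumr_const card_prod card_ord muln1 -[_ *+ _]mulr_natr mulVf //.
by rewrite pnatr_eq0 -lt0n card_labels_gt0.
Qed.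

Definition uniform_mc : mdp L 'I_1 :=
  @Mdp L 'I_1 _ (fun=> [:: uniform_move]) uniform_init_distr uniform_move_distr
    (fun=> isT) (fun=> isT).

Lemma uniform_mcP : is_mc uniform_mc. Proof. by []. Qed.

Lemma uniform_strategy (R : realType) :
  is_strategy uniform_mc (fun _ _ => 1 : R).
Proof. by move=> rho; split=> [m _|]; rewrite ?big_seq1 ?ler01. Qed.

Lemma uniform_trace (R : realType) alpha (w : seq L) :
  is_strategy uniform_mc alpha ->
  trace_prob uniform_mc alpha w = #|L|%:R^-1 ^+ size w :> R.
Proof.
move=> alphaP; rewrite trace_probE -size_rev; move: (rev w) => rw.
elim: rw => [|l rw IH] /=; first by rewrite big_ord1 ffunE rmorph1 mulr1.
rewrite exprS -IH -[RHS]mulr1 -mulrA mulr1 -expectZ; apply: eq_expect => rho _.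
rewrite big_ord1 mulr1 /step_prob big_seq1 ffunE fmorphV rmorph_nat.
by have [_] := alphaP rho; rewrite big_seq1 => ->; rewrite mul1r mulr1.
Qed.

End Uniform.

(** * The MDP that compares two weights *)

Section Comparison.
Variables (L Q : finType) (lx ly : L) (sink : Q).
Variables (W : L -> Q -> Q -> rat) (U V : pred Q) (mu : {ffun Q -> rat}).
Hypothesis lxy : lx != ly.
Hypothesis W_ge0 : forall l q q', 0 <= W l q q'.
Hypothesis W_lx : forall q q', W lx q q' = 0.
Hypothesis W_ly : forall q q', W ly q q' = 0.
Hypothesis W_from_sink : forall l q, W l sink q = 0.
Hypothesis UV : forall q, U q -> ~~ V q.
Hypothesis U_sink : ~~ U sink.
Hypothesis V_sink : ~~ V sink.
Hypothesis mu_distr : is_distr mu.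

Fixpoint weight (rw : seq L) (q : Q) : rat :=
  if rw is l :: rw' then \sum_q' weight rw' q' * W l q' q else mu q.

(** The sum of all entries bounds every row sum; the summand [1] keeps the inverse positive when all
    entries vanish. *)
Definition scale : rat := (1 + \sum_l \sum_q \sum_q' W l q q')^-1.
Definition label_prob : rat := #|L|%:R^-1.
(** Relative to the uniform distribution, [lx] gets the factor [e], [ly] the factor [2 - e] and
    every other label the factor [1]; hence the range 0 to 2 for [e]. *)
Definition bias (e : rat) (l : L) : rat :=
  1 + (e - 1) * ((l == lx)%:R - (l == ly)%:R).

(* Whatever the bias [e], the move outputs the letters with the same rescaled
   weights; the missing mass goes to the sink.  The bias only shifts mass
   between the outputs [lx] and [ly]. *)
Definition biased_move (q : Q) (e : rat) : {ffun L * Q -> rat} :=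
  [ffun x => label_prob *
     (scale * W x.1 q x.2 +
      (bias e x.1 - scale * \sum_q' W x.1 q q') * (x.2 == sink)%:R)].

(** Mixing [2] and [0] realises any mean bias in between, so states of [U] are free; states of [V]
    never output [lx], and the others are neutral. *)
Definition biases (q : Q) : seq rat :=
  if U q then [:: 2; 0] else if V q then [:: 0] else [:: 1].

Lemma label_prob_gt0 : 0 < label_prob.
Proof. by rewrite invr_gt0 ltr0n (card_labels_gt0 lx). Qed.

Lemma scale_gt0 : 0 < scale.
Proof.
rewrite invr_gt0 ltr_pwDl // sumr_ge0 // => l _; rewrite sumr_ge0 // => q _.
exact: sumr_ge0.
Qed.

Lemma scaled_le1 l q : scale * (\sum_q' W l q q') <= 1.
Proof.
rewrite mulrC ler_pdivrMr; last by rewrite -invr_gt0 scale_gt0.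
rewrite mul1r; set S := (X in X <= _).
rewrite (bigD1 l) //= (bigD1 q) //= -/S.
set A := \sum_(i | i != q) _; set B := \sum_(i | i != l) _.
have A0 : 0 <= A by rewrite sumr_ge0 // => x _; exact: sumr_ge0.
have B0 : 0 <= B.
  by do 2![rewrite sumr_ge0 // => ? _]; exact: sumr_ge0.
by move: A0 B0; lra.
Qed.

Lemma biasesP q e : e \in biases q -> 0 <= e <= 2.
Proof.
rewrite /biases; case: ifP => _; last case: ifP => _; rewrite !inE.
- by case/orP => /eqP ->.
- by move/eqP->.
- by move/eqP->.
Qed.

Lemma biased_move_ge0 q e x : 0 <= e <= 2 -> 0 <= biased_move q e x.
Proof.
case/andP=> e0 e2; rewrite ffunE mulr_ge0 ?(ltW label_prob_gt0) //.
rewrite addr_ge0 ?mulr_ge0 ?ler0n ?(ltW scale_gt0) // subr_ge0 /bias.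
(* At [lx] and [ly] no weight is carried, so the coefficient of the sink is [e] or [2 - e]; at other
   labels it is 1 minus a scaled row sum. *)
have [->|nlx] := eqVneq x.1 lx.
  by rewrite (negPf lxy) big1 // mulr0 /=; move: e0; lra.
have [->|nly] := eqVneq x.1 ly.
  by rewrite big1 // mulr0 /=; move: e2; lra.
by rewrite subr0 mulr0 addr0 scaled_le1.
Qed.

Lemma biased_move_label q e l :
  \sum_q' biased_move q e (l, q') = label_prob * bias e l.
Proof.
under eq_bigr do rewrite ffunE /=.
rewrite -mulr_sumr big_split /= -!mulr_sumr.
have -> : \sum_q' (q' == sink)%:R = 1 :> rat.
  by rewrite (bigD1 sink) //= eqxx big1 ?addr0 // => q' /negPf ->.
by congr (_ * _); ring.
Qed.

Lemma biased_move_distr q e : 0 <= e <= 2 -> is_distr (biased_move q e).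
Proof.
move=> e02; split=> [x|]; first exact: biased_move_ge0.
transitivity (\sum_l \sum_q' biased_move q e (l, q')).
  by rewrite pair_big; apply: eq_bigr => -[].
under eq_bigr do rewrite biased_move_label.
have ind1 l0 : \sum_l (l == l0 :> L)%:R = 1 :> rat.
  by rewrite (bigD1 l0) //= eqxx big1 ?addr0 // => q' /negPf ->.
rewrite -mulr_sumr big_split /= -mulr_sumr sumrB !ind1 subrr mulr0 addr0.
rewrite sumr_const -[1 *+ _]/(_%:R) mulVf //.
by rewrite pnatr_eq0 -lt0n (card_labels_gt0 lx).
Qed.

Lemma biased_move_inj q : injective (biased_move q).
Proof.
move=> e e' /ffunP/(_ (lx, sink)); rewrite !ffunE /= W_lx eqxx /bias eqxx.
rewrite (negPf lxy) => /(mulfI (lt0r_neq0 label_prob_gt0)) /=; lra.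
Qed.

Lemma comparison_distr q m :
  m \in [seq biased_move q e | e <- biases q] -> is_distr m.
Proof. by case/mapP=> e /biasesP e02 ->; apply: biased_move_distr. Qed.

Lemma comparison_uniq q : uniq [seq biased_move q e | e <- biases q].
Proof.
rewrite map_inj_uniq; last exact: biased_move_inj.
by rewrite /biases; case: ifP => // _; case: ifP.
Qed.

Lemma comparison_nonempty q : [seq biased_move q e | e <- biases q] != [::].
Proof. by rewrite /biases; case: ifP => // _; case: ifP. Qed.

Definition comparison_mdp : mdp L Q :=
  Mdp mu_distr comparison_distr comparison_uniq comparison_nonempty.

Variable R : realType.
Local Notation D := comparison_mdp.
Local Notation p := (ratr label_prob : R).

Definition mean_bias (alpha : mdp_path L Q -> {ffun L * Q -> rat} -> R)
    (rho : mdp_path L Q) : R :=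
  \sum_(e <- biases (last_state rho))
     alpha rho (biased_move (last_state rho) e) * ratr e.

Section Strategy.
Variable alpha : mdp_path L Q -> {ffun L * Q -> rat} -> R.
Hypothesis alphaP : is_strategy D alpha.

Lemma sum_alpha rho :
  \sum_(e <- biases (last_state rho)) alpha rho (biased_move (last_state rho) e) = 1.
Proof. by have [_] := alphaP rho; rewrite /= big_map. Qed.

(** Off the sink a move does not depend on its bias, so the choices of the strategy sum out to 1. *)
Lemma step_off_sink rho l (g : Q -> R) : g sink = 0 ->
  \sum_q step_prob D alpha rho l q * g q =
  p * ratr scale * \sum_q ratr (W l (last_state rho) q) * g q.
Proof.
move=> g0; rewrite mulr_sumr; apply: eq_bigr => q _.
have [->|qs] := eqVneq q sink; first by rewrite g0 !mulr0.
rewrite [RHS]mulrA; congr (_ * _); rewrite /step_prob /= big_map.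
under eq_bigr do rewrite ffunE /= (negPf qs) mulr0 addr0 !rmorphM.
by rewrite -mulr_suml sum_alpha mul1r mulrA.
Qed.

(** The sink completes the mass of each label, so state and strategy act on the next label only
    through the mean bias. *)
Lemma step_label rho l : \sum_q step_prob D alpha rho l q =
  p * (1 + (mean_bias alpha rho - 1) * ((l == lx)%:R - (l == ly)%:R)).
Proof.
rewrite /step_prob exchange_big /= big_map.
under eq_bigr do rewrite -mulr_sumr -rmorph_sum biased_move_label rmorphM /=.
set d : R := (l == lx)%:R - _.
have biasE e : ratr (bias e l) = 1 - d + d * ratr e :> R.
  by rewrite /bias rmorphD rmorphM !rmorphB !rmorph1 !rmorph_nat -/d; ring.
under eq_bigr => e _.
  rewrite biasE (_ : _ * _ = p * (1 - d) * alpha rho (biased_move (last_state rho) e)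
    + p * d * (alpha rho (biased_move (last_state rho) e) * ratr e)); last by ring.
  over.
rewrite big_split /= -!mulr_sumr sum_alpha -/(mean_bias alpha rho); ring.
Qed.

(** No strategy can influence the weights: off the sink the moves of a state agree, and mass in the
    sink never comes back because [W] vanishes there. *)
Lemma expect_weight rw (g : Q -> R) : g sink = 0 ->
  expect D alpha rw (fun rho => g (last_state rho)) =
  (p * ratr scale) ^+ size rw * \sum_q ratr (weight rw q) * g q.
Proof.
elim: rw g => [|l rw IH] g g0 /=; first by rewrite mul1r.
under eq_expect => rho _ do rewrite step_off_sink //.
rewrite expectZ (IH (fun q => \sum_q' ratr (W l q q') * g q')); last first.
  by rewrite big1 // => q _; rewrite W_from_sink rmorph0 mul0r.
rewrite mulrA -exprS; congr (_ * _) => /=.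
under eq_bigr do rewrite mulr_sumr.
rewrite exchange_big /=; apply: eq_bigr => q _; rewrite rmorph_sum mulr_suml.
by apply: eq_bigr => q' _; rewrite rmorphM mulrA.
Qed.

Lemma expect_pred rw (A : pred Q) : ~~ A sink ->
  expect D alpha rw (fun rho => (A (last_state rho))%:R) =
  (p * ratr scale) ^+ size rw * ratr (\sum_(q | A q) weight rw q).
Proof.
move=> As; rewrite (@expect_weight rw (fun q => (A q)%:R)) ?(negPf As) //.
congr (_ * _); rewrite [in RHS]big_mkcond rmorph_sum; apply: eq_bigr => q _.
by case: (A q); rewrite ?mulr1 ?mulr0 ?rmorph0.
Qed.

Lemma mean_bias_le rho : mean_bias alpha rho <=
  1 + ((U (last_state rho))%:R - (V (last_state rho))%:R).
Proof.
have := sum_alpha rho; have [ge0 _] := alphaP rho; move: ge0.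
rewrite /mean_bias /= /biases; case: ifPn => Uq; last case: ifPn => Vq.
- rewrite (negPf (UV Uq)) !big_cons !big_nil => ge0.
  (* The last move is the one of bias 0; since its probability is nonnegative, that of bias 2 is at
     most 1. *)
  have := ge0 _ (mem_last _ _); rewrite ratr_nat rmorph0 /=; lra.
- by rewrite !big_seq1 rmorph0 /= => _; lra.
- by rewrite !big_seq1 rmorph1 /= => _; lra.
Qed.

End Strategy.

Definition U_weight rw := \sum_(q | U q) weight rw q.
Definition V_weight rw := \sum_(q | V q) weight rw q.

Lemma weight_ge0 rw q : 0 <= weight rw q.
Proof.
elim: rw q => [|l rw IH] q /=; first by case: mu_distr.
by apply: sumr_ge0 => q' _; rewrite mulr_ge0.
Qed.

(* Shifts the mean bias to [1 + V/U] on [U], which exactly compensates for the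
   mean bias [0] on [V]. *)
Definition balancing (rho : mdp_path L Q) (m : {ffun L * Q -> rat}) : R :=
  let q := last_state rho in let rw := unzip1 rho.2 in
  let t := ratr ((1 + V_weight rw / U_weight rw) / 2) in
  if U q then if m == biased_move q 2 then t else 1 - t else 1.

Lemma balancing_strategy : (forall rw, V_weight rw <= U_weight rw) ->
  is_strategy D balancing.
Proof.
move=> VU rho; rewrite /balancing /= /biases.
set rw := unzip1 _; set q := last_state _; set t := ratr _.
case: ifP => Uq; last by case: ifP => _; rewrite big_seq1; split=> // m _.
have t01 : 0 <= t <= 1.
  rewrite /t ler0q -[X in _ && (_ <= X)](rmorph1 (@ratr R)) ler_rat.
  have U0 : 0 <= U_weight rw by apply: sumr_ge0 => *; apply: weight_ge0.
  have V0 : 0 <= V_weight rw by apply: sumr_ge0 => *; apply: weight_ge0.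
  have : 0 <= V_weight rw / U_weight rw <= 1.
    rewrite divr_ge0 //=.
    (* When [U] has weight 0 the quotient is 0 by convention, and [t] is 1/2. *)
    have [->|U1] := eqVneq (U_weight rw) 0; first by rewrite invr0 mulr0.
    by rewrite ler_pdivrMr ?mul1r // lt0r U1.
  lra.
split=> [m _|]; first by case: ifP => _; move: t01; lra.
rewrite !big_cons big_nil eqxx (inj_eq (@biased_move_inj q)) /=; lra.
Qed.

Lemma balancing_mean rho : mean_bias balancing rho =
  1 + (U (last_state rho))%:R * ratr (V_weight (unzip1 rho.2) / U_weight (unzip1 rho.2))
    - (V (last_state rho))%:R.
Proof.
rewrite /mean_bias /balancing /biases; set q := last_state _; set rw := unzip1 _.
case: ifPn => Uq; last case: ifPn => Vq.
- rewrite !big_cons big_nil eqxx (negPf (UV Uq)) ratr_nat rmorph0 mulr0 !addr0.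
  rewrite [ratr ((_ + _) / _)]fmorph_div rmorphD rmorph1 rmorph_nat subr0 mul1r.
  by rewrite mulfVK // pnatr_eq0.
- by rewrite !big_seq1 rmorph0 mulr0 mul0r addr0 subrr.
- by rewrite !big_seq1 rmorph1 mulr1 mul0r addr0 subr0.
Qed.

(** If a strategy matches the chain, its mean bias has the same expectation as the constant 1 after
    every word; being at most [1 + U - V] pointwise, it forces [V <= U]. Conversely [balancing]
    makes the surplus on [U] equal to the deficit on [V]. *)
Lemma comparison_refines : trace_refines R (uniform_mc lx) D <->
  forall rw, V_weight rw <= U_weight rw.
Proof.
split=> [|VU].
  move=> /(_ _ (uniform_strategy lx R)) [beta betaP tr] rw.
  have ps_gt0 : 0 < p * ratr scale.
    by rewrite mulr_gt0 ?ltr0q ?label_prob_gt0 ?scale_gt0.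
  have {}tr r : expect D beta r (fun=> 1) = p ^+ size r.
    have := tr (rev r); rewrite [RHS]trace_probE revK => <-.
    rewrite (uniform_trace _ (uniform_strategy lx R)) size_rev.
    by rewrite /label_prob fmorphV rmorph_nat.
  (* Extending the word by [lx] reads off the mean bias, since the factor of [lx] is the bias
     itself. *)
  have mean : expect D beta rw (mean_bias beta) = p ^+ size rw.
    have := tr (lx :: rw); rewrite exprS /=.
    under eq_expect => rho _.
      under eq_bigr do rewrite mulr1.
      rewrite step_label // eqxx (negPf lxy) subr0 mulr1 addrC subrK.
      over.
    rewrite expectZ => /mulfI; apply; rewrite gt_eqF // ltr0q.
    exact: label_prob_gt0.
  have := le_expect betaP rw (mean_bias_le betaP).
  rewrite mean !expectD tr lerDl.
  under [X in _ + X]eq_expect => rho _ do rewrite -mulN1r.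
  rewrite expectZ !expect_pred // mulN1r subr_ge0.
  by rewrite ler_pM2l ?exprn_gt0 // ler_rat.
move=> alpha alphaP; have betaP := balancing_strategy VU.
exists balancing => // w; rewrite (uniform_trace _ alphaP) trace_probE -size_rev.
have -> : #|L|%:R^-1 = p by rewrite /label_prob fmorphV rmorph_nat.
elim: (rev w) => [|l rw IH] /=.
  under eq_bigr do rewrite mulr1.
  by case: mu_distr => _; rewrite -rmorph_sum => ->; rewrite rmorph1.
under eq_expect => rho _.
  under eq_bigr do rewrite mulr1.
  rewrite step_label // balancing_mean.
  over.
rewrite exprS expectZ IH; congr (_ * _).
set d : R := _ - _.
transitivity (expect D balancing rw (fun rho =>
  1 + (d * ratr (V_weight rw / U_weight rw) * (U (last_state rho))%:R
       + (- d) * (V (last_state rho))%:R))); last first.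
  by apply: eq_expect => rho ->; ring.
rewrite !expectD !expectZ !expect_pred // -/(U_weight rw) -/(V_weight rw).
rewrite [X in _ = _ + X](_ : _ = 0) ?addr0 //.
have key : ratr (V_weight rw / U_weight rw) * ratr (U_weight rw) =
    ratr (V_weight rw) :> R.
  rewrite -rmorphM /=.
  (* If [U] has weight 0 then so has [V], squeezed between 0 and it, which agrees with the default
     value of the quotient. *)
  have [U0|U0] := eqVneq (U_weight rw) 0; last by rewrite divfK.
  rewrite U0 mulr0; congr ratr; apply/esym/eqP; rewrite eq_le -{1}U0 VU /=.
  by apply: sumr_ge0 => *; apply: weight_ge0.
by rewrite mulNr -mulrA [X in d * X]mulrCA key subrr.
Qed.

End Comparison.

(** * Counter programs as weights *)

(* [Copy r r'] is the assignment x_r := x_r'.  A [Test] has no effect in [exec];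
   whether it succeeds is recorded by [passes]. *)
Inductive cmd := Copy of nat & nat | Incr of nat | Test of nat & nat.

Definition regs : Type := nat -> nat.

Definition exec (c : cmd) (s : regs) : regs :=
  match c with
  | Copy r r' => fun q => if q == r then s r' else s q
  | Incr r => fun q => if q == r then (s q).+1 else s q
  | Test _ _ => s
  end.

Definition passes (c : cmd) (s : regs) : bool :=
  if c is Test r r' then s r == s r' else true.

Definition cmd_below (k : nat) (c : cmd) : bool :=
  match c with
  | Copy r r' | Test r r' => (r < k)%N && (r' < k)%N
  | Incr r => (r < k)%N
  end.

Section Runs.
Variables (N : finType) (E : seq (N * cmd * N)) (start bad : N) (s0 : regs).

Definition edge (e : 'I_(size E)) : N * cmd * N := tnth (in_tuple E) e.
Definition ecmd (e : 'I_(size E)) : cmd := (edge e).1.2.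

(* In the functions below the most recent edge comes first. *)
Definition node_step (e : 'I_(size E)) (c : N) : N :=
  if c == (edge e).1.1 then (edge e).2 else bad.
Definition node_after (es : seq 'I_(size E)) : N := foldr node_step start es.
Definition regs_after (es : seq 'I_(size E)) : regs :=
  foldr (fun e => exec (ecmd e)) s0 es.
Fixpoint tests_ok (es : seq 'I_(size E)) : bool :=
  if es is e :: es' then tests_ok es' && passes (ecmd e) (regs_after es') else true.

End Runs.

(** * The instance built from a control graph and an input *)

Section Encoding.
Variables (N : finType) (E : seq (N * cmd * N)) (start final bad : N).
Variables (k' n : nat).
Local Notation k := k'.+2.
Hypothesis E_below : forall e : 'I_(size E), cmd_below k (ecmd e).

(** Register [0] starts at zero and supplies the constant; the input takes the next one, hence at
    least two registers. *)
Definition input_regs : regs := fun r => if r == 1%N then n else 0%N.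
Local Notation node := (@node_after N E start bad).
Local Notation rgs := (@regs_after N E input_regs).
Local Notation ok := (@tests_ok N E input_regs).
Local Notation label := 'I_(3 + size E).
Local Notation main_state := ('I_3 + (N + 'I_k * 'I_k))%type.
Local Notation state := 'I_(3 + #|{: main_state}|).

(** Instances need ordinals as states. The three initial states come first, so that the code of the
    initial distribution is three entries followed by zeros. *)
Definition decode (q : state) : 'I_3 + main_state :=
  match split q with inl a => inl a | inr j => inr (enum_val j) end.
Definition encode (x : 'I_3 + main_state) : state :=
  match x with inl a => lshift _ a | inr y => rshift 3 (enum_rank y) end.

Lemma encodeK : cancel encode decode.
Proof.
case=> [a|y]; rewrite /decode /encode; first by rewrite (unsplitK (inl a)).
by rewrite (unsplitK (inr (enum_rank y))) enum_rankK.
Qed.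

Lemma decodeK : cancel decode encode.
Proof.
move=> q; rewrite /decode -[RHS]splitK; case: (split q) => //= j.
by rewrite enum_valK.
Qed.

Lemma sum_states (F : 'I_3 + main_state -> rat) :
  \sum_q F (decode q) =
  \sum_a F (inl a) + (\sum_a F (inr (inl a)) +
   (\sum_c F (inr (inr (inl c))) + \sum_x F (inr (inr (inr x))))).
Proof.
transitivity (\sum_x F x).
  by rewrite (reindex decode) //; apply/onW_bij/(Bijective decodeK encodeK).
by rewrite !big_sumType.
Qed.

(** Labels [0] and [1] are reserved for [label_x] and [label_y]. *)
Definition init_label : label := lshift _ (inord 2 : 'I_3).
Definition edge_label (e : 'I_(size E)) : label := rshift 3 e.

(** After [Copy r r'], register [i] holds what register [rename r r' i] held before. *)
Definition rename (r r' : nat) (i : 'I_k) : 'I_k :=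
  if i == r :> nat then inord r' else i.

(* The states are three initial ones, of initial weights proportional to [1],
   [2 ^ - n] and [2 ^ n]; then, for [a] = 0, 1, 2 in [inr (inl a)], the sink, the
   accumulator and the counter of tests; the nodes of the control graph; and the
   pairs [(i, j)], of weight [2 ^ (x_i - x_j)].  The counter starts at 1/2 and
   increases by [2] at each test, so that the accumulator outweighs it unless all
   tests were passed. *)
Definition init_weight (a : nat) (x : main_state) : rat :=
  match x with
  | inr (inr (i, j)) =>
      (a == (if (i == 1 :> nat) == (j == 1 :> nat) then 0
             else if j == 1 :> nat then 1 else 2))%:R
  | inr (inl c) => ((a == 0) && (c == start))%:R
  | inl b => ((a == 0) && (b == 2 :> nat))%:R / 2
  end.

(** On pairs, a copy pulls back the indices and an increment scales by a power of 2. A test feeds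
    both ratios to the accumulator and twice the pair [(0, 0)], which has the unit weight, to the
    counter. The sink has no outgoing weight. *)
Definition edge_weight (e : 'I_(size E)) (x x' : main_state) : rat :=
  match x, x' with
  | inr (inr y), inr (inr (i, j)) =>
      match ecmd e with
      | Copy r r' => (y == (rename r r' i, rename r r' j))%:R
      | Incr r => (y == (i, j))%:R * (2 ^+ (i == r :> nat) / 2 ^+ (j == r :> nat))
      | Test _ _ => (y == (i, j))%:R
      end
  | inr (inr y), inl a =>
      if ecmd e is Test r r' then
        if a == 1 :> nat then
          (y == (inord r, inord r'))%:R + (y == (inord r', inord r))%:R
        else if a == 2 :> nat then (y == (ord0, ord0))%:R * 2
        else 0
      else 0
  | inl a, inl b => ((a == b) && (a != 0 :> nat))%:R
  | inr (inl c), inr (inl c') => (node_step bad e c == c')%:R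
  | _, _ => 0
  end.

Definition trans_weight (l : label) (q q' : state) : rat :=
  match split l, decode q, decode q' with
  | inl a, inl b, inr x => if a == 2 :> nat then init_weight b x else 0
  | inr e, inr x, inr x' => edge_weight e x x'
  | _, _, _ => 0
  end.

(** This is [2 ^ n] times the sum of 1, [2 ^ - n] and [2 ^ n]; the cleared numerators are coprime to
    it, so the fractions are reduced. *)
Definition norm : nat := ((2 ^ n) ^ 2 + 2 ^ n + 1)%N.
Definition initial_weights : seq rat :=
  [:: (2 ^ n)%:R / norm%:R; 1%:R / norm%:R; ((2 ^ n) ^ 2)%:R / norm%:R].
Definition initial : {ffun state -> rat} :=
  [ffun q : state => initial_weights`_q].

(** A node counts for 1, more than the head start 1/2 of the counter, so the comparison can fail
    only where the walk ends in [final]. *)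
Definition is_U (q : state) : bool :=
  match decode q with
  | inr (inl a) => a == 1 :> nat
  | inr (inr (inl c)) => c != final
  | _ => false
  end.
Definition is_V (q : state) : bool :=
  if decode q is inr (inl a) then a == 2 :> nat else false.
Definition sink_state : state := encode (inr (inl ord0)).

Definition ratio (s : regs) (i j : nat) : rat := 2 ^+ s i / 2 ^+ s j.

Fixpoint test_sum (es : seq 'I_(size E)) : rat :=
  if es is e :: es' then
    test_sum es' +
    (if ecmd e is Test r r' then ratio (rgs es') r r' + ratio (rgs es') r' r else 0)
  else 0.

Fixpoint test_count (es : seq 'I_(size E)) : rat :=
  if es is e :: es' then
    test_count es' + (if ecmd e is Test _ _ then 2 else 0)
  else 0.

(** The weights reached along [es], up to a factor common to all main states, which does not affect
    comparisons. *)
Definition run_weight (es : seq 'I_(size E)) (x : main_state) : rat :=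
  match x with
  | inr (inr (i, j)) => ratio (rgs es) i j
  | inr (inl c) => (c == node es)%:R
  | inl a => if a == 1 :> nat then test_sum es
             else if a == 2 :> nat then test_count es + 1 / 2 else 0
  end.

Local Notation wt := (weight trans_weight initial).

Lemma norm_gt0 : 0 < norm%:R :> rat.
Proof. by rewrite ltr0n /norm addn1. Qed.

Lemma initial_pre (a : 'I_3) : initial (encode (inl a)) =
  (if a == 0 :> nat then (2 ^ n)%:R else if a == 1 :> nat then 1%:R
   else ((2 ^ n) ^ 2)%:R) / norm%:R.
Proof. by rewrite ffunE; case: a => [[|[|[|]]]]. Qed.

Lemma initial_main x : initial (encode (inr x)) = 0.
Proof. by rewrite ffunE nth_default. Qed.

Lemma initial_distr : is_distr initial.
Proof.
split=> [q|].
  by rewrite ffunE; case: (q : nat) => [|[|[|m]]];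
    rewrite /= ?nth_nil ?divr_ge0 ?ler0n.
under eq_bigr do rewrite -[X in initial X]decodeK.
rewrite (sum_states (fun x => initial (encode x))).
rewrite !(big1 _ _ _ (fun x _ => initial_main _)) !addr0.
rewrite !big_ord_recl big_ord0 !initial_pre /= addr0 -!mulrDl -!natrD.
rewrite (_ : (_ + _)%N = norm) ?divff ?gt_eqF ?norm_gt0 // /norm.
by rewrite addnCA addnC (addnC (2 ^ n)%N).
Qed.

Lemma trans_weight_ge0 l q q' : 0 <= trans_weight l q q'.
Proof.
rewrite /trans_weight; case: (split l) => [a|e]; case: (decode q) => [b|x] //;
  case: (decode q') => [c|y] //; last first.
  case: x => [a|[c|[i j]]]; case: y => [a'|[c'|[i' j']]] //=; rewrite ?ler0n //;
    case: (ecmd e) => // *; rewrite ?ler0n //.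
    by case: ifP => _; last case: ifP => _ //; rewrite ?addr_ge0 ?mulr_ge0 ?ler0n.
  by rewrite !mulr_ge0 ?ler0n ?invr_ge0 ?exprn_ge0.
case: ifP => // _; case: y => [a'|[c'|[i' j']]] /=; rewrite ?ler0n //.
by rewrite mulr_ge0 ?ler0n.
Qed.

Lemma trans_weight_pre l q a : trans_weight l q (encode (inl a)) = 0.
Proof. by rewrite /trans_weight encodeK; case: (split l); case: (decode q). Qed.

Lemma trans_weight_edge e x y :
  trans_weight (edge_label e) (encode (inr x)) (encode (inr y)) = edge_weight e x y.
Proof. by rewrite /trans_weight !encodeK (unsplitK (inr e)). Qed.

Lemma trans_weight_edge_pre e a q :
  trans_weight (edge_label e) (encode (inl a)) q = 0.
Proof. by rewrite /trans_weight encodeK (unsplitK (inr e)). Qed.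

Lemma trans_weight_init a y :
  trans_weight init_label (encode (inl a)) (encode (inr y)) = init_weight a y.
Proof. by rewrite /trans_weight !encodeK (unsplitK (inl _)) inordK. Qed.

Lemma trans_weight_init_main x q :
  trans_weight init_label (encode (inr x)) q = 0.
Proof. by rewrite /trans_weight encodeK (unsplitK (inl _)). Qed.

Lemma weight_cons l rw q : wt (l :: rw) q =
  \sum_a wt rw (encode (inl a)) * trans_weight l (encode (inl a)) q +
  (\sum_a wt rw (encode (inr (inl a))) * trans_weight l (encode (inr (inl a))) q +
   (\sum_c wt rw (encode (inr (inr (inl c)))) *
           trans_weight l (encode (inr (inr (inl c)))) q +
    \sum_y wt rw (encode (inr (inr (inr y)))) *
           trans_weight l (encode (inr (inr (inr y)))) q)).
Proof.
rewrite /= -(sum_states (fun x => wt rw (encode x) * trans_weight l (encode x) q)).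
by apply: eq_bigr => q' _; rewrite decodeK.
Qed.

Lemma weight_init x :
  wt [:: init_label] (encode (inr x)) = (2 ^ n)%:R / norm%:R * run_weight [::] x.
Proof.
rewrite weight_cons [X in _ + (X + _)]big1 => [|a _]; last first.
  by rewrite trans_weight_init_main mulr0.
rewrite [X in _ + (_ + (X + _))]big1 => [|c _]; last first.
  by rewrite trans_weight_init_main mulr0.
rewrite [X in _ + (_ + (_ + X))]big1 => [|y _]; last first.
  by rewrite trans_weight_init_main mulr0.
rewrite !addr0.
rewrite !big_ord_recl big_ord0 !trans_weight_init /= !initial_pre /= addr0.
have N0 : (2 ^ n)%:R != 0 :> rat by rewrite pnatr_eq0 expn_eq0.
have Z0 := gt_eqF norm_gt0.
case: x => [a|[c|[i j]]] /=.
- case: ifP => [/eqP ->|_] /=; first by rewrite !mul0r !mulr0 !addr0.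
  by case: ifP => _ /=; rewrite ?add0r !mul0r !mulr0 !addr0.
- by rewrite !mulr0 !addr0.
rewrite /ratio /input_regs.
(* The exponent of 2 is [n - n], [n], [- n] or 0. *)
case: (i == 1 :> nat); case: (j == 1 :> nat) => /=;
  rewrite ?(mulr0, mulr1, addr0, add0r, expr0, divr1, invr1) -?natrX.
- by rewrite divff ?mulr1.
- by rewrite natrX expr2 mulrAC.
- by rewrite mulrA mulr1 mulrAC divff.
- by [].
Qed.

Lemma weight_edge e rw x : wt (edge_label e :: rw) (encode (inr x)) =
  \sum_a wt rw (encode (inr (inl a))) * edge_weight e (inl a) x +
   (\sum_c wt rw (encode (inr (inr (inl c)))) * edge_weight e (inr (inl c)) x +
    \sum_y wt rw (encode (inr (inr (inr y)))) * edge_weight e (inr (inr y)) x).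
Proof.
rewrite weight_cons [X in X + _]big1 ?add0r; last first.
  by move=> a _; rewrite trans_weight_edge_pre mulr0.
by congr (_ + (_ + _)); apply: eq_bigr => y _; rewrite trans_weight_edge.
Qed.

Lemma sum_delta (T : finType) (x : T) (F : T -> rat) :
  \sum_y F y * (y == x)%:R = F x.
Proof.
rewrite (bigD1 x) //= eqxx mulr1 big1 ?addr0 // => y /negPf ->.
by rewrite mulr0.
Qed.

Lemma sum_deltaM (T : finType) (x : T) (c : rat) (F : T -> rat) :
  \sum_y F y * ((y == x)%:R * c) = F x * c.
Proof. by under eq_bigr do rewrite mulrA; rewrite -mulr_suml sum_delta. Qed.

(** The factor is fixed by the initial distribution; each edge then maps [run_weight es] linearly to
    [run_weight (e :: es)]. *)
Lemma weight_run es x :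
  wt (map edge_label es ++ [:: init_label]) (encode (inr x)) =
  (2 ^ n)%:R / norm%:R * run_weight es x.
Proof.
elim: es x => [|e es IH] x; first exact: weight_init.
move: IH; set eps := _ / _ => IH.
rewrite [map _ _ ++ _]/= weight_edge.
under eq_bigr do rewrite IH -mulrA.
under [X in _ + (X + _)]eq_bigr do rewrite IH -mulrA.
under [X in _ + (_ + X)]eq_bigr do rewrite IH -mulrA.
rewrite -!mulr_sumr -!mulrDr; congr (_ * _).
have := E_below e; case: x => [a|[c|[i j]]].
- rewrite [X in _ + (X + _)]big1 ?add0r; last by move=> c _; rewrite mulr0.
  move=> eb; have -> : \sum_b run_weight es (inl b) * edge_weight e (inl b) (inl a)
      = run_weight es (inl a).
    have [a0|a0] := eqVneq (a : nat) 0%N.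
      rewrite big1 => [|b _] /=; first by rewrite a0.
      by have [->|] := eqVneq b a; rewrite ?a0 mulr0.
    transitivity (\sum_b run_weight es (inl b) * (b == a)%:R).
      apply: eq_bigr => b _; rewrite /=; congr (_ * _%:R).
      by have [->|//] := eqVneq b a; rewrite a0.
    exact: sum_delta.
  rewrite /=; case: (ecmd e) eb => [r r'|r|r r'] /= eb.
  + by rewrite big1 => [|y _]; rewrite ?mulr0 // !addr0.
  + by rewrite big1 => [|y _]; rewrite ?mulr0 // !addr0.
  case/andP: eb => rk rk'.
  case: ifP => _; last case: ifP => _;
    last by rewrite big1 => [|y _]; rewrite ?mulr0 ?addr0.
    under eq_bigr do rewrite mulrDr.
    rewrite big_split /= !sum_delta /= !inordK //.
  (* The ratio at [(0, 0)] is 1, so the counter gains exactly 2. *)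
  rewrite sum_deltaM /ratio divff ?mul1r ?expf_neq0 //; lra.
- rewrite [X in X + _]big1 ?add0r; last by move=> a _; rewrite mulr0.
  rewrite [X in _ + X]big1 ?addr0; last by move=> y _; rewrite mulr0.
  move=> _ /=; under eq_bigr do rewrite mulrC.
  by rewrite sum_delta eq_sym.
- rewrite [X in X + _]big1 ?add0r; last by move=> a _; rewrite mulr0.
  rewrite [X in X + _]big1 ?add0r; last by move=> a _; rewrite mulr0.
  rewrite /= /ratio /=; case: (ecmd e) => [r r'|r|r r'] /= eb.
  + rewrite sum_delta /= /rename; case/andP: eb => rk rk'.
    by case: ifP => _; case: ifP => _; rewrite ?inordK.
  + rewrite sum_deltaM /= mulrACA -invfM -!exprD.
    by congr (_ ^+ _ / _ ^+ _); case: ifP => _; rewrite ?addn1 ?addn0.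
  + by rewrite sum_delta.
Qed.

(** Initial states are left by [init_label] alone, which has no other use, and are never re-entered;
    so a word carries weight only if it reads that label first and edges afterwards. *)
Lemma weight_bad rw :
  (exists es, rw = map edge_label es ++ [:: init_label]) \/
  forall x, wt rw (encode (inr x)) = 0.
Proof.
elim: rw => [|l rw IH]; first by right=> x; apply: initial_main.
have [El|nl] := eqVneq l init_label; last first.
  case: (splitP l) => [a la|e le]; last first.
    have {le}-> : l = edge_label e by apply: val_inj.
    case: IH => [[es ->]|IH]; first by left; exists (e :: es).
    right=> x; rewrite weight_edge !big1 ?addr0 // => y _; by rewrite IH mul0r.
  right=> x; rewrite [LHS]big1 // => q _.
  rewrite (_ : trans_weight _ _ _ = 0) ?mulr0 //.
  have {}la : l = lshift _ a by apply: val_inj.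
  rewrite /trans_weight encodeK la (unsplitK (inl a)).
  case: (decode q) => // b; case: eqP => // a2; case/eqP: nl.
  by rewrite la; congr lshift; apply: val_inj; rewrite /= inordK.
rewrite El; case: rw {IH} => [|l' rw]; first by left; exists [::].
right=> x; rewrite weight_cons !big1 ?addr0 // => y _;
  rewrite ?trans_weight_init_main ?mulr0 //.
by rewrite [wt _ _]big1 ?mul0r // => q _; rewrite trans_weight_pre mulr0.
Qed.

Lemma U_weightE rw : U_weight trans_weight is_U initial rw =
  wt rw (encode (inr (inl (inord 1)))) +
  \sum_(c | c != final) wt rw (encode (inr (inr (inl c)))).
Proof.
rewrite /U_weight big_mkcond /=.
under eq_bigr do rewrite -[X in wt _ X]decodeK.
rewrite (sum_states (fun x => if match x with
  | inr (inl a) => a == 1 :> nat | inr (inr (inl c)) => c != final | _ => false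
  end then wt rw (encode x) else 0)).
rewrite big1 // add0r [X in _ + (_ + X)]big1 // addr0 -!big_mkcond /=.
congr (_ + _); rewrite (big_pred1 (inord 1)) // => a.
by rewrite /= -val_eqE /= inordK.
Qed.

Lemma V_weightE rw : V_weight trans_weight is_V initial rw =
  wt rw (encode (inr (inl (inord 2)))).
Proof.
rewrite /V_weight big_mkcond /=.
under eq_bigr do rewrite -[X in wt _ X]decodeK.
rewrite (sum_states (fun x => if (if x is inr (inl a) then a == 2 :> nat else false)
  then wt rw (encode x) else 0)).
rewrite big1 // add0r [X in _ + X](_ : _ = 0) ?addr0; last by rewrite !big1 ?addr0.
rewrite -big_mkcond (big_pred1 (inord 2)) // => a.
by rewrite /= -val_eqE /= inordK.
Qed.

(** The function [x + 1 / x] has minimum 2 at 1, and is at least 5/2 once [x] or its inverse is at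
    least 2, as for distinct exponents. *)
Lemma ratio_sum s i j : 2 + (s i != s j)%:R / 2 <= ratio s i j + ratio s j i.
Proof.
wlog ltij : i j / (s i < s j)%N => [IH|].
  case: (ltngtP (s i) (s j)) (IH i j) (IH j i) => [_ /(_ isT) //|_ _|eqij _ _].
    by move/(_ isT)/le_trans; apply; rewrite addrC.
  by rewrite /ratio eqij divff ?expf_neq0 //; lra.
rewrite /ratio ltn_eqF // -(subnK ltij).
set d := (_ - _)%N; rewrite addnS -addSn exprD exprS.
have a0 : (2 : rat) ^+ s i != 0 by rewrite expf_neq0.
have y1 : 1 <= (2 : rat) ^+ d by rewrite exprn_ege1.
set x := 2 * 2 ^+ d; have x2 : 2 <= x by rewrite /x; lra.
rewrite mulfK // invfM mulrCA divff // mulr1.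
have xz : x * x^-1 = 1 by rewrite divff //; move: x2; lra.
have z0 : 0 <= x^-1 by rewrite invr_ge0; lra.
have z2 : x^-1 <= 1 / 2 by nra.
(* The product expands to [x + 1 / x - 5 / 2]. *)
have : 0 <= (x - 2) * (1 - x^-1 / 2) by apply: mulr_ge0; lra.
rewrite /=; lra.
Qed.

(** Each test adds at least 2 and a failed one at least 5/2, so a failure is never made up for
    later. *)
Lemma tests_gap es : test_count es + (~~ ok es)%:R / 2 <= test_sum es.
Proof.
elim: es => [|e es IH] /=; first by rewrite mul0r addr0.
case: (ecmd e) => [r r'|r|r r'] /=; rewrite ?andbT ?addr0 //.
have := ratio_sum (rgs es) r r'; move: IH.
case: (ok es); case: eqP => _ /=; lra.
Qed.

Lemma tests_passed es : ok es -> test_sum es = test_count es.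
Proof.
elim: es => [//|e es IH] /= /andP[/IH -> ].
case: (ecmd e) => [r r'|r|r r'] //= /eqP eqr.
by rewrite /ratio eqr divff ?expf_neq0.
Qed.

(** When all tests pass and [final] is reached, the head start of the counter remains uncovered.
    Otherwise a failed test covers it with 1/2, or the node with 1. *)
Lemma dominated_words :
  (forall rw, V_weight trans_weight is_V initial rw <=
              U_weight trans_weight is_U initial rw) <->
  ~ exists es, ok es && (node es == final).
Proof.
have eps_gt0 : 0 < (2 ^ n)%:R / norm%:R :> rat.
  by rewrite divr_gt0 ?norm_gt0 // ltr0n expn_gt0.
have VU es : (V_weight trans_weight is_V initial (map edge_label es ++ [:: init_label])
    <= U_weight trans_weight is_U initial (map edge_label es ++ [:: init_label])) =
  (test_count es + 1 / 2 <= test_sum es + (node es != final)%:R).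
  rewrite U_weightE V_weightE !weight_run /= !inordK //=.
  under eq_bigr do rewrite weight_run /=.
  rewrite -mulr_sumr -mulrDr ler_pM2l //; congr (_ <= _ + _).
  rewrite big_mkcond (bigD1 (node es)) //= eqxx big1 ?addr0 => [|c /negPf ->].
    by case: ifP.
  by case: ifP.
split=> [le [es /andP[ok_es /eqP fin]]|no rw].
  by have := le (map edge_label es ++ [:: init_label]); rewrite VU fin eqxx
    (tests_passed ok_es) /=; lra.
have [[es ->]|bad_rw] := weight_bad rw; last first.
  by rewrite U_weightE V_weightE !bad_rw big1.
rewrite VU; have := tests_gap es.
case: (boolP (ok es)) => ok_es; case: (eqVneq (node es) final) => fin /=; try lra.
by case: no; exists es; rewrite ok_es fin eqxx.
Qed.

Definition label_x : label := lshift _ (ord0 : 'I_3).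
Definition label_y : label := lshift _ (inord 1 : 'I_3).

Lemma label_xy : label_x != label_y.
Proof. by rewrite -val_eqE /= inordK. Qed.

Lemma trans_weight_x q q' : trans_weight label_x q q' = 0.
Proof.
by rewrite /trans_weight (unsplitK (inl _)); case: (decode q) => //; case: (decode q').
Qed.

Lemma trans_weight_y q q' : trans_weight label_y q q' = 0.
Proof.
rewrite /trans_weight (unsplitK (inl _)) inordK //.
by case: (decode q) => //; case: (decode q').
Qed.

Lemma trans_weight_sink l q : trans_weight l sink_state q = 0.
Proof.
rewrite /trans_weight encodeK; case: (split l) => // e.
by case: (decode q) => // -[b|[c|[i j]]] //=; rewrite andbF.
Qed.

Lemma is_UV q : is_U q -> ~~ is_V q.
Proof. by rewrite /is_U /is_V; case: (decode q) => // -[a /eqP ->|]. Qed.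

Lemma sink_notU : ~~ is_U sink_state. Proof. by rewrite /is_U encodeK. Qed.
Lemma sink_notV : ~~ is_V sink_state. Proof. by rewrite /is_V encodeK. Qed.

Definition program_mdp : mdp label state :=
  comparison_mdp sink_state is_U is_V label_xy trans_weight_ge0
    trans_weight_x trans_weight_y initial_distr.

Definition program_instance : instance :=
  Instance program_mdp (uniform_mcP label_x).

Lemma program_instanceP (R : realType) : MC_refines_MDP R program_instance <->
  ~ exists es, ok es && (node es == final).
Proof.
apply: iff_trans dominated_words.
exact: (comparison_refines _ _ _ _ trans_weight_sink is_UV sink_notU sink_notV).
Qed.

End Encoding.

(** * Control graphs of programs *)

Section Programs.

Inductive prog := Cmd of cmd | Seq of prog & prog | Star of prog.

Lemma cmd_eq_dec : comparable cmd.
Proof. by move=> c d; rewrite /decidable; decide equality; apply: eq_comparable. Qed.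
HB.instance Definition _ := hasDecEq.Build cmd (compareP cmd_eq_dec).

Lemma prog_eq_dec : comparable prog.
Proof. by move=> p q; rewrite /decidable; decide equality; apply: eq_comparable. Qed.
HB.instance Definition _ := hasDecEq.Build prog (compareP prog_eq_dec).

Inductive star (T : Type) (r : T -> T -> Prop) : T -> T -> Prop :=
| star_refl x : star r x x
| star_step x y z : r x y -> star r y z -> star r x z.

Lemma star_rcons T (r : T -> T -> Prop) x y z : star r x y -> r y z -> star r x z.
Proof.
elim=> [x' xz|x' y' z' xy _ IH /IH]; last exact: star_step.
exact: star_step xz (star_refl _ _).
Qed.

Lemma star_invariant T (r : T -> T -> Prop) (I : T -> Prop) x y :
  (forall x y, I x -> r x y -> I y) -> I x -> star r x y -> I y.
Proof.
move=> rI Ix xy; elim: xy Ix => // x' y' z' xy' _ IH Ix'; apply: IH.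
exact: rI xy'.
Qed.

Fixpoint run (p : prog) (s s' : regs) : Prop :=
  match p with
  | Cmd c => passes c s /\ s' = exec c s
  | Seq p q => exists2 t, run p s t & run q t s'
  | Star p => star (run p) s s'
  end.

Fixpoint run_seq (ps : seq prog) (s s' : regs) : Prop :=
  if ps is p :: ps' then exists2 t, run p s t & run_seq ps' t s' else s = s'.

(** Edges that only move control carry this test, which always passes. *)
Definition noop : cmd := Test 0 0.

(* The control graph of [p]: a node is the list of programs that remain to be
   run, [k] being what remains after [p]. *)
Fixpoint control (p : prog) (k : seq prog) : seq (seq prog * cmd * seq prog) :=
  match p with
  | Cmd c => [:: (p :: k, c, k)]
  | Seq p1 p2 => (p :: k, noop, [:: p1, p2 & k]) :: control p1 (p2 :: k) ++ control p2 k
  | Star p1 =>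
      [:: (p :: k, noop, k), (p :: k, noop, [:: p1, p & k]) & control p1 (p :: k)]
  end.

Fixpoint max_reg (p : prog) : nat :=
  match p with
  | Cmd (Copy r r') | Cmd (Test r r') => maxn r r'
  | Cmd (Incr r) => r
  | Seq p q => maxn (max_reg p) (max_reg q)
  | Star p => max_reg p
  end.

Lemma cmd_below_leq m n c : (m <= n)%N -> cmd_below m c -> cmd_below n c.
Proof. by case: c => /= *; lia. Qed.

Lemma control_below p k e :
  e \in control p k -> cmd_below (max_reg p).+2 e.1.2.
Proof.
elim: p k => [c|p1 IH1 p2 IH2|p IH] k /=.
- by rewrite inE => /eqP -> /=; case: c => /= *; lia.
- rewrite inE mem_cat => /orP[/eqP -> //|/orP[/IH1|/IH2]];
  by apply: cmd_below_leq; lia.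
- by rewrite !inE => /or3P[/eqP -> //|/eqP -> //|/IH].
Qed.

(** Each edge is one unfolding of [run_seq], so a run of what remains after it extends backwards. *)
Lemma control_sound p k e s s' : e \in control p k -> passes e.1.2 s ->
  run_seq e.2 (exec e.1.2 s) s' -> run_seq e.1.1 s s'.
Proof.
elim: p k => [c|p1 IH1 p2 IH2|p IH] k /=.
- by rewrite inE => /eqP -> /= cs; exists (exec c s).
- rewrite inE mem_cat => /orP[/eqP -> /= _ [t st [u tu us']]|/orP[/IH1|/IH2]] //.
  by exists u => //; exists t.
- rewrite !inE => /or3P[/eqP -> /= _ ks|/eqP -> /= _ [t st [u tu us']]|/IH] //.
    by exists s => //; apply: star_refl.
  by exists u => //; apply: star_step tu.
Qed.

Variables (p : prog) (s0 : regs).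
Local Notation ctl := (control p [::]).
Definition nodes : seq (seq prog) :=
  [:: [:: p]; [::]] ++ map (fun e => e.1.1) ctl ++ map snd ctl.
(** Control nodes must form a finite type, so lists are numbered. The extra last ordinal is the
    number of no listed node and serves as [bad]. *)
Definition node_of (k : seq prog) : 'I_(size nodes).+1 := inord (index k nodes).
Definition control_edges := [seq (node_of e.1.1, e.1.2, node_of e.2) | e <- ctl].
Local Notation E := control_edges.
Local Notation node := (@node_after _ E (node_of [:: p]) ord_max).
Local Notation rgs := (@regs_after _ E s0).
Local Notation ok := (@tests_ok _ E s0).

Lemma node_of_val k : node_of k = index k nodes :> nat.
Proof. by rewrite inordK // ltnS index_size. Qed.

Lemma node_of_inj k k' : k \in nodes -> node_of k = node_of k' -> k = k'.
Proof.
move=> kn /(congr1 val); rewrite /= !node_of_val => eqk.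
by rewrite -(nth_index [::] kn) eqk nth_index // -index_mem -eqk index_mem.
Qed.

Lemma control_nodes e : e \in ctl -> (e.1.1 \in nodes) * (e.2 \in nodes).
Proof.
move=> ec; rewrite !mem_cat; split.
  by rewrite (map_f (fun e => e.1.1) ec) orbT.
by rewrite (map_f snd ec) !orbT.
Qed.

Lemma control_edgesP (e : 'I_(size E)) :
  exists2 c, c \in ctl & edge e = (node_of c.1.1, c.1.2, node_of c.2).
Proof. by apply/mapP; apply: mem_tnth. Qed.

Lemma control_edges_below (e : 'I_(size E)) : cmd_below (max_reg p).+2 (ecmd e).
Proof.
by rewrite /ecmd; have [c /control_below cb ->] := control_edgesP e.
Qed.

(** The invariant looks ahead: whatever completes the remaining programs completes a run of [p] from
    [s0]. *)
Lemma walk_sound es : ok es -> node es = ord_max \/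
  exists k, [/\ k \in nodes, node es = node_of k &
                forall s, run_seq k (rgs es) s -> run p s0 s].
Proof.
elim: es => [_|e es IH /= /andP[/IH {}IH pass]].
  right; exists [:: p]; split=> // [|s]; first by rewrite inE eqxx.
  by case=> t pt <-.
rewrite /node_step; case: eqP => [eqn|_]; last by left.
right; move: eqn pass; rewrite /ecmd.
have [c cc ->] := control_edgesP e => /= eqn pass.
exists c.2; split=> // [|s]; first by rewrite control_nodes.
move/(control_sound cc pass).
(* No edge starts at [ord_max], so a walk that has strayed cannot rejoin the graph. *)
case: IH => [bad|[k [kn eqk]]].
  have := control_nodes cc; move: eqn; rewrite bad => /(congr1 val) /=.
  by rewrite node_of_val -!index_mem => <- []; rewrite ltnn.
by rewrite eqn in eqk; rewrite (node_of_inj _ eqk) ?control_nodes //; apply.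
Qed.

Lemma walk_step k1 c k2 es : (k1, c, k2) \in ctl -> ok es ->
  node es = node_of k1 -> passes c (rgs es) ->
  exists es', [/\ ok es', node es' = node_of k2 & rgs es' = exec c (rgs es)].
Proof.
move=> cc oks nodes pass.
have : (node_of k1, c, node_of k2) \in E by apply: (map_f _ cc).
move/seq_tnthP => [i ei].
exists (i :: es); rewrite /= oks /node_step /ecmd /edge -ei /=.
by rewrite nodes eqxx.
Qed.

(** Induction on [q] for any continuation [k]. A star returns to its own node, hence an inner
    induction on its iterations. *)
Lemma walk_complete q k s s' es : {subset control q k <= ctl} -> run q s s' ->
  ok es -> node es = node_of (q :: k) -> rgs es = s ->
  exists es', [/\ ok es', node es' = node_of k & rgs es' = s'].
Proof.
elim: q k s s' es => [c|q1 IH1 q2 IH2|q IH] k s s' es sub /=.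
- case=> pass -> oks nodek rg; rewrite -rg; apply: walk_step nodek _ => //.
    by apply: sub; rewrite inE.
  by rewrite rg.
- case=> t q1t q2t oks nodek rg.
  have c0 : (Seq q1 q2 :: k, noop, [:: q1, q2 & k]) \in ctl.
    by apply: sub; rewrite inE eqxx.
  have [es1 [ok1 node1 rg1]] := walk_step c0 oks nodek (eqxx _).
  have [||es2 [ok2 node2 rg2]] := IH1 (q2 :: k) _ _ _ _ q1t ok1 node1 _.
  + by move=> x xq; apply: sub; rewrite inE mem_cat xq orbT.
  + by rewrite rg1 rg.
  apply: IH2 q2t ok2 node2 rg2.
  by move=> x xq; apply: sub; rewrite inE mem_cat xq !orbT.
- move=> sq oks; elim: sq es oks => [x|x y z qxy _ IHs] es oks nodek rg.
    have c0 : (Star q :: k, noop, k) \in ctl by apply: sub; rewrite inE eqxx.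
    have [es1 [ok1 node1 rg1]] := walk_step c0 oks nodek (eqxx _).
    by exists es1; split=> //; rewrite rg1 rg.
  have c0 : (Star q :: k, noop, [:: q, Star q & k]) \in ctl.
    by apply: sub; rewrite !inE eqxx orbT.
  have [es1 [ok1 node1 rg1]] := walk_step c0 oks nodek (eqxx _).
  have [||es2 [ok2 node2 rg2]] := IH (Star q :: k) _ _ _ _ qxy ok1 node1 _.
  + by move=> u uq; apply: sub; rewrite !inE uq !orbT.
  + by rewrite rg1 rg.
  exact: IHs ok2 node2 rg2.
Qed.

Lemma control_correct : (exists es, ok es && (node es == node_of [::])) <->
  exists s, run p s0 s.
Proof.
split=> [[es /andP[oks /eqP nodee]]|[s ps]].
  have [bad|[k [kn nodek all]]] := walk_sound oks.
    have : [::] \in nodes by rewrite !inE.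
    by rewrite -index_mem -node_of_val -nodee bad ltnn.
  exists (rgs es); apply: all; rewrite nodee in nodek.
  by rewrite -(node_of_inj _ nodek) // !inE.
have [//|es [oks nodes _]] :=
  @walk_complete p [::] s0 s [::] _ ps isT (erefl _) (erefl _).
by exists es; rewrite oks nodes eqxx.
Qed.

End Programs.

(** * Programs that check recursive functions *)

Definition seqs (ps : seq prog) : prog := foldr Seq (Cmd noop) ps.

Lemma run_seqs ps s s' : run (seqs ps) s s' <-> run_seq ps s s'.
Proof.
elim: ps s => [|p ps IH] s /=; first by split=> [[_ ->]|->]; rewrite ?eqxx.
by split=> -[t pt /IH]; exists t.
Qed.

Lemma run_seq_cat ps qs s s' :
  run_seq (ps ++ qs) s s' <-> exists2 t, run_seq ps s t & run_seq qs t s'.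
Proof.
elim: ps s => [|p ps IH] s /=; first by split=> [|[t ->]]; [exists s|].
split=> [[t pt /IH[u pu qu]]|[u [t pt pu] qu]].
  by exists u => //; exists t.
by exists t => //; apply/IH; exists u.
Qed.

(* Guesses a value for [r]; register [0] is expected to contain [0]. *)
Definition havoc (r : nat) : prog := Seq (Cmd (Copy r 0)) (Star (Cmd (Incr r))).

Definition same_except (r : nat) (s s' : regs) : Prop :=
  forall q, q != r -> s' q = s q.

Definition agree (b : nat) (s s' : regs) : Prop :=
  forall q, (q < b)%N -> s' q = s q.

Lemma agree_trans b s1 s2 s3 : agree b s1 s2 -> agree b s2 s3 -> agree b s1 s3.
Proof. by move=> a12 a23 q qb; rewrite a23 ?a12. Qed.

Lemma agree_leq b c s s' : (b <= c)%N -> agree c s s' -> agree b s s'.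
Proof. by move=> bc a q qb; apply: a; apply: leq_trans bc. Qed.

Lemma agree_except b r s s' : (b <= r)%N -> same_except r s s' -> agree b s s'.
Proof. by move=> br a q qb; apply: a; rewrite neq_ltn (leq_trans qb br). Qed.

Lemma exec_Copy_except r r' s : same_except r s (exec (Copy r r') s).
Proof. by move=> q /negPf qr; rewrite /= qr. Qed.

Lemma exec_Incr_except r s : same_except r s (exec (Incr r) s).
Proof. by move=> q /negPf qr; rewrite /= qr. Qed.

Lemma havoc_except r s s' : run (havoc r) s s' -> same_except r s s'.
Proof.
case=> t [_ ->]; apply: (star_invariant (I := same_except r s)).
  by move=> x y sx [_ ->] q qr; rewrite exec_Incr_except // sx.
exact: exec_Copy_except.
Qed.

Lemma havoc_value r s v : s 0%N = 0%N -> exists2 s', run (havoc r) s s' & s' r = v.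
Proof.
move=> s0; suff [s' ss' s'v] : exists2 s',
    star (run (Cmd (Incr r))) (exec (Copy r 0) s) s' & s' r = v.
  by exists s' => //; exists (exec (Copy r 0) s).
elim: v => [|v [s' ss' s'v]].
  by exists (exec (Copy r 0) s); [apply: star_refl | rewrite /= eqxx].
exists (exec (Incr r) s'); first exact: star_rcons ss' _.
by rewrite /= eqxx s'v.
Qed.

Lemma guess_frame rs s s' : run_seq [seq havoc r | r <- rs] s s' ->
  forall q, q \notin rs -> s' q = s q.
Proof.
elim: rs s => [|r rs IH] s /=; first by move=> ->.
by case=> t /havoc_except st /IH ts q; rewrite inE negb_or => /andP[qr /ts ->]; apply: st.
Qed.

Lemma guess_value rs s (F : nat -> nat) : s 0%N = 0%N -> 0%N \notin rs ->
  exists2 s', run_seq [seq havoc r | r <- rs] s s' &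
              forall r, r \in rs -> s' r = F r.
Proof.
elim: rs s => [|r rs IH] s s0 /=; first by exists s.
rewrite inE negb_or => /andP[r0 rs0].
have [t st tr] := havoc_value r (F r) s0.
have [|//|s' ts' s'F] := IH t; first by rewrite (havoc_except st).
exists s'; first by exists t.
move=> q; rewrite inE; have [/s'F //|qrs] := boolP (q \in rs).
by rewrite orbF => /eqP Eq; rewrite (guess_frame ts') // Eq.
Qed.

Definition vals n (s : regs) (xs : n.-tuple nat) : n.-tuple nat := map_tuple s xs.
Definition all_below (b n : nat) (xs : n.-tuple nat) : bool :=
  all (fun x => x < b)%N xs.

Lemma vals_agree b n s s' (xs : n.-tuple nat) :
  all_below b xs -> agree b s s' -> vals s' xs = vals s xs.
Proof.
by move=> /allP xsb ss'; apply/val_inj/eq_in_map => x /xsb; apply: ss'.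
Qed.

Lemma all_below_leq b c n (xs : n.-tuple nat) :
  (b <= c)%N -> all_below b xs -> all_below c xs.
Proof. by move=> bc; apply: sub_all => x /leq_trans; apply. Qed.

(* [check f xs y b] runs to completion iff [f] maps the values of the registers
   [xs] to that of [y]; it only modifies registers that are at least [b]. *)
Fixpoint check n (f : recfun n) : n.-tuple nat -> nat -> nat -> prog :=
  match f in recfun n return n.-tuple nat -> nat -> nat -> prog with
  | RZero _ => fun _ y _ => Cmd (Test y 0)
  | RSucc => fun xs y b =>
      seqs [:: Cmd (Copy b (thead xs)); Cmd (Incr b); Cmd (Test y b)]
  | RProj _ i => fun xs y _ => Cmd (Test y (tnth xs i))
  | RComp n k f g => fun xs y b =>
      seqs ([seq havoc r | r <- iota b k] ++
            [seq check (g i) xs (b + i)%N (b + k)%N | i <- enum 'I_k] ++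
            [:: check f [tuple (b + i)%N | i < k] y (b + k)%N])
  | RPrec n f g => fun xs y b =>
      seqs [:: havoc b.+1; check f [tuple of behead xs] b.+1 b.+3; Cmd (Copy b 0);
               Star (seqs [:: havoc b.+2;
                  check g [tuple of b :: b.+1 :: [tuple of behead xs]] b.+2 b.+3;
                  Cmd (Copy b.+1 b.+2); Cmd (Incr b)]);
               Cmd (Test b (thead xs)); Cmd (Test y b.+1)]
  | RMu n f => fun xs y b =>
      seqs [:: Cmd (Copy b 0);
               Star (seqs [:: havoc b.+1; check f [tuple of b :: xs] b.+1 b.+3;
                  havoc b.+2; Cmd (Incr b.+2); Cmd (Test b.+1 b.+2); Cmd (Incr b)]);
               Cmd (Test b y); Cmd (Copy b.+1 0);
               check f [tuple of y :: xs] b.+1 b.+3]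
  end.

Definition check_sound n (f : recfun n) := forall xs y b s s',
  (0 < b)%N -> (y < b)%N -> all_below b xs -> s 0%N = 0%N ->
  run (check f xs y b) s s' -> agree b s s' /\ computes f (vals s xs) (s y).

(** Nothing is claimed about the final registers: that low registers are kept follows from
    [check_sound] for the run obtained. *)
Definition check_complete n (f : recfun n) := forall xs y b s,
  (0 < b)%N -> (y < b)%N -> all_below b xs -> s 0%N = 0%N ->
  computes f (vals s xs) (s y) -> exists s', run (check f xs y b) s s'.

Lemma vals_thead n s (xs : n.+1.-tuple nat) : thead (vals s xs) = s (thead xs).
Proof. by case/tupleP: xs. Qed.

Lemma vals_behead n s (xs : n.+1.-tuple nat) :
  [tuple of behead (vals s xs)] = vals s [tuple of behead xs].
Proof. by apply: val_inj; case: xs => -[]. Qed.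

Lemma vals_cons n s x (xs : n.-tuple nat) :
  vals s [tuple of x :: xs] = [tuple of s x :: vals s xs].
Proof. exact: val_inj. Qed.

(** * Checking compositions *)

Section Comp.
Variables (n k : nat) (f : recfun k) (g : 'I_k -> recfun n).

(** The guessed intermediate values lie just below [b + k], where the scratch registers of all
    subchecks begin, so they survive until [f] is checked. *)
Lemma check_sound_comp : check_sound f -> (forall i, check_sound (g i)) ->
  check_sound (RComp f g).
Proof.
move=> sf sg xs y b s s' b0 yb xsb s0 /run_seqs/run_seq_cat[s1].
move=> /guess_frame fr /run_seq_cat[s2 run12 [s3 run23 <-]] {s'}.
have a01 : agree b s s1.
  by move=> q qb; apply: fr; rewrite mem_iota; move: qb; lia.
have s10 : s1 0%N = 0%N by rewrite a01.
have bk : (b <= b + k)%N by rewrite leq_addr.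
have [a12 g12] : agree (b + k) s1 s2 /\
    forall i, i \in enum 'I_k -> computes (g i) (vals s xs) (s1 (b + i)%N).
  elim: (enum 'I_k) s1 s10 a01 run12 {fr} => [|i js IH] s1 s10 a01 /=.
    by move=> <-; split.
  case=> t run1t runt2.
  have [|||a1t ci] := sg i _ _ _ _ _ _ _ _ s10 run1t; rewrite ?ltn_add2l //.
  - by lia.
  - exact: all_below_leq xsb.
  have [||at2 cis] := IH t _ _ runt2; first by rewrite a1t //; lia.
  - exact: agree_trans a01 (agree_leq bk a1t).
  split=> [|j]; first exact: agree_trans a1t at2.
  rewrite inE => /orP[/eqP ->|/cis]; first by rewrite -(vals_agree xsb a01).
  by rewrite a1t // ltn_add2l.
have [||||a23 cf] := sf _ _ _ _ _ _ _ _ _ run23.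
- by lia.
- by lia.
- by apply/all_tnthP => i; rewrite tnth_mktuple /= ltn_add2l.
- by rewrite a12 //; lia.
have a02 : agree b s s2 := agree_trans a01 (agree_leq bk a12).
split; first exact: agree_trans a02 (agree_leq bk a23).
exists (vals s2 [tuple (b + i)%N | i < k]); last by rewrite -(a02 y).
move=> i; rewrite tnth_map tnth_mktuple a12 ?ltn_add2l //.
by apply: g12; rewrite mem_enum.
Qed.

Lemma check_complete_comp : check_sound f -> (forall i, check_sound (g i)) ->
  check_complete f -> (forall i, check_complete (g i)) ->
  check_complete (RComp f g).
Proof.
move=> sf sg cf cg xs y b s b0 yb xsb s0 [u gu fu].
(* The right guess for register [b + i] is the [i]-th intermediate value. *)
pose F r := nth 0%N u (r - b)%N.
have [|s1 run1 s1F] := @guess_value (iota b k) s F s0.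
  by rewrite mem_iota; lia.
have a01 : agree b s s1.
  by move=> q qb; apply: (guess_frame run1); rewrite mem_iota; move: qb; lia.
have bk : (b <= b + k)%N by rewrite leq_addr.
have [s2 run12 a12] : exists2 s2,
   run_seq [seq check (g i) xs (b + i)%N (b + k)%N | i <- enum 'I_k] s1 s2 &
   agree (b + k) s1 s2.
  have s1u (i : 'I_k) : s1 (b + i)%N = tnth u i.
    rewrite s1F; last by rewrite mem_iota leq_addr ltn_add2l /=.
    by rewrite /F addKn (tnth_nth 0%N).
  suff aux js t : agree (b + k) s1 t -> exists2 s2,
      run_seq [seq check (g i) xs (b + i)%N (b + k)%N | i <- js] t s2 &
      agree (b + k) s1 s2.
    by apply: (aux (enum 'I_k) s1).
  elim: js t => [|i js IH] t a1t /=; first by exists t.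
  have a0t : agree b s t := agree_trans a01 (agree_leq bk a1t).
  have [|||||t' tt'] := cg i xs (b + i)%N (b + k)%N t.
  - by lia.
  - by rewrite ltn_add2l.
  - exact: all_below_leq xsb.
  - by rewrite a0t.
  - by rewrite (vals_agree xsb a0t) a1t ?ltn_add2l // s1u; apply: gu.
  have [||||att' _] := sg i _ _ _ _ _ _ _ _ _ tt'.
  - by lia.
  - by rewrite ltn_add2l.
  - exact: all_below_leq xsb.
  - by rewrite a0t.
  have [s2 run2 a12] := IH t' (agree_trans a1t att').
  by exists s2 => //; exists t'.
have a02 : agree b s s2 := agree_trans a01 (agree_leq bk a12).
have [|||||s3 run23] := cf [tuple (b + i)%N | i < k] y (b + k)%N s2.
- by lia.
- by lia.
- by apply/all_tnthP => i; rewrite tnth_mktuple /= ltn_add2l.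
- by rewrite a02.
- rewrite a02 // (_ : vals _ _ = u) //; apply: eq_from_tnth => i.
  rewrite tnth_map tnth_mktuple a12 ?ltn_add2l // s1F.
    by rewrite /F addKn (tnth_nth 0%N).
  by rewrite mem_iota leq_addr ltn_add2l /=.
exists s3; apply/run_seqs/run_seq_cat; exists s1 => //.
by apply/run_seq_cat; exists s2 => //; exists s3.
Qed.

End Comp.

(** * Checking primitive recursions *)

Section Prec.
Variables (n : nat) (f : recfun n) (g : recfun n.+2).

(** A name for the local fixpoint of [computes], to which it is convertible. *)
Definition prec_rel (x : n.-tuple nat) : nat -> nat -> Prop :=
  fix prec t y :=
    if t is t'.+1 then exists2 z, prec t' z & computes g [tuple of t' :: z :: x] y
    else computes f x y.

(** Register [b] counts the rounds, [b.+1] holds the current value and [b.+2] a guess of the next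
    one. *)
Definition prec_body (xs : n.+1.-tuple nat) (b : nat) : prog :=
  seqs [:: havoc b.+2;
           check g [tuple of b :: b.+1 :: [tuple of behead xs]] b.+2 b.+3;
           Cmd (Copy b.+1 b.+2); Cmd (Incr b)].

Lemma all_below_behead b (xs : n.+1.-tuple nat) :
  all_below b xs -> all_below b [tuple of behead xs].
Proof. by case/tupleP: xs => x xs /= /andP[]. Qed.

Lemma all_below_thead b (xs : n.+1.-tuple nat) : all_below b xs -> (thead xs < b)%N.
Proof. by case/tupleP: xs => x xs /= /andP[]. Qed.

Lemma vals_behead_agree b s s' (xs : n.+1.-tuple nat) :
  all_below b xs -> agree b s s' ->
  @vals n s' [tuple of behead xs] = @vals n s [tuple of behead xs].
Proof. by move=> xsb; apply: vals_agree (all_below_behead xsb). Qed.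

Lemma vals_cons2 m s x y (xs : m.-tuple nat) :
  vals s [tuple of x :: y :: xs] = [tuple of s x :: s y :: vals s xs].
Proof. exact: val_inj. Qed.

Definition prec_inv (xs : n.+1.-tuple nat) b s t :=
  agree b s t /\ prec_rel (vals s [tuple of behead xs]) (t b) (t b.+1).

Lemma prec_body_sound xs b s t t' : check_sound g -> (0 < b)%N ->
  all_below b xs -> s 0%N = 0%N -> prec_inv xs b s t -> run (prec_body xs b) t t' ->
  prec_inv xs b s t'.
Proof.
move=> sg b0 xsb s0 [ast Pt] /run_seqs[t1 /havoc_except e1].
have at1 : agree b.+2 t t1 by apply: agree_except e1.
have [b2 b3] : (b < b.+2)%N /\ (b < b.+3)%N by lia.
have xb3 : all_below b.+3 [tuple of behead xs].
  by apply: all_below_leq (all_below_behead xsb); lia.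
have as1 : agree b s t1 := agree_trans ast (agree_leq (leqW (leqnSn b)) at1).
case=> t2 /sg[||||a2 c2].
- by [].
- by lia.
- by rewrite /all_below /=; apply/and3P; split=> //; lia.
- by rewrite as1.
case=> _ [_ ->] [_ [_ ->] <-] {t'}; split.
  move=> q qb; rewrite /= !ltn_eqF ?ltnS ?(ltnW qb) // a2 ?as1 //.
  by rewrite !ltnS; lia.
rewrite /= !eqxx (ltn_eqF (ltnSn b)) (gtn_eqF (ltnSn b)) a2 ?ltnS ?leqnSn //.
rewrite a2 // (at1 b) //; exists (t b.+1) => //.
move: c2; rewrite vals_cons2.
by rewrite (vals_behead_agree xsb as1) (at1 b) // (at1 b.+1).
Qed.

Lemma check_sound_prec : check_sound f -> check_sound g -> check_sound (RPrec f g).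
Proof.
move=> sf sg xs y b s s' b0 yb xsb s0 /run_seqs[t1 /havoc_except e1].
have a1 : agree b.+1 s t1 by apply: agree_except e1.
case=> t2 /sf[||||a2 c2].
- by [].
- by lia.
- by apply: all_below_leq (all_below_behead xsb); lia.
- by rewrite a1.
case=> t3 [_ t3E]; have {t3E} I3 : prec_inv xs b s t3.
  rewrite {}t3E; split=> [q qb|] /=.
    by rewrite ltn_eqF // a2 ?a1 //; lia.
  rewrite eqxx (gtn_eqF (ltnSn b)) a2 //.
  rewrite a2 // a1 // s0; move: c2.
  by rewrite (vals_behead_agree xsb (agree_leq (leqnSn b) a1)).
case=> t4 st4; have [] : prec_inv xs b s t4.
  apply: star_invariant I3 st4 => u u'; exact: prec_body_sound.
move=> a4 p4 [_ [/= /eqP Et ->] [_ [/= /eqP Ey ->] <-]].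
split=> //; change (prec_rel [tuple of behead (vals s xs)] (thead (vals s xs)) (s y)).
rewrite vals_behead vals_thead -(a4 _ (all_below_thead xsb)) -Et.
by rewrite -(a4 _ yb) Ey.
Qed.

Lemma check_complete_prec : check_sound f -> check_sound g ->
  check_complete f -> check_complete g -> check_complete (RPrec f g).
Proof.
move=> sf sg cf cg xs y b s b0 yb xsb s0 P.
change (prec_rel [tuple of behead (vals s xs)] (thead (vals s xs)) (s y)) in P.
rewrite vals_behead vals_thead in P.
(* Each value rests on the previous one, so the claim is generalised over the number of rounds and a
   round is appended at the end of the star. *)
suff {P} loop T Z : prec_rel (vals s [tuple of behead xs]) T Z -> exists t1 t2 t4,
    [/\ run (havoc b.+1) s t1, run (check f [tuple of behead xs] b.+1 b.+3) t1 t2,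
        star (run (prec_body xs b)) (exec (Copy b 0) t2) t4, prec_inv xs b s t4
        & t4 b = T /\ t4 b.+1 = Z].
  have [t1 [t2 [t4 [r1 r2 r4 [a4 _] [Et Ey]]]]] := loop _ _ P.
  exists t4; apply/run_seqs; exists t1 => //; exists t2 => //.
  exists (exec (Copy b 0) t2) => //; exists t4 => //.
  exists t4; first by rewrite /= Et a4 ?all_below_thead.
  by exists t4 => //; rewrite /= Ey a4.
elim: T Z => [|T IH] Z /=.
  move=> cfZ; have [t1 r1 t1Z] := havoc_value b.+1 Z s0.
  have a1 : agree b.+1 s t1 by apply: agree_except (havoc_except r1).
  have x1 := vals_behead_agree xsb (agree_leq (leqnSn b) a1).
  have xb3 : all_below b.+3 [tuple of behead xs].
    by apply: all_below_leq (all_below_behead xsb); lia.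
  have [||||t2 r2] := cf [tuple of behead xs] b.+1 b.+3 t1 _ _ xb3.
  - by [].
  - by lia.
  - by rewrite a1.
  - by rewrite x1 t1Z.
  have [|||a2 _] := sf _ _ _ _ _ _ _ xb3 _ r2.
  - by [].
  - by lia.
  - by rewrite a1.
  exists t1, t2, (exec (Copy b 0) t2).
  have Eb : exec (Copy b 0) t2 b = 0%N by rewrite /= eqxx a2 // a1.
  have Eb1 : exec (Copy b 0) t2 b.+1 = Z.
    by rewrite /= (gtn_eqF (ltnSn b)) a2.
  split=> //; first exact: star_refl.
  split; last by rewrite Eb Eb1.
  by move=> q qb /=; rewrite ltn_eqF // a2 ?a1 //; lia.
case=> z /IH[t1 [t2 [t4 [r1 r2 r4 I4 [Et Ez]]]]] cgZ.
have a4 := I4.1.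
have t40 : t4 0%N = 0%N by rewrite a4.
have [t5 r5 t5Z] := havoc_value b.+2 Z t40.
have a5 : agree b.+2 t4 t5 by apply: agree_except (havoc_except r5).
have xb3 : all_below b.+3 [tuple of b :: b.+1 :: [tuple of behead xs]].
  rewrite /all_below /=; apply/and3P; split=> //; try lia.
  by apply: all_below_leq (all_below_behead xsb); lia.
have as5 : agree b s t5 := agree_trans a4 (agree_leq (leqW (leqnSn b)) a5).
have [||||t6 r6] := cg _ b.+2 b.+3 t5 _ _ xb3.
- by [].
- by lia.
- by rewrite as5.
- rewrite vals_cons2 (vals_behead_agree xsb as5) (a5 b) // (a5 b.+1) //.
  by rewrite Et Ez t5Z.
have [|||a6 _] := sg _ _ _ _ _ _ _ xb3 _ r6.
- by [].
- by lia.
- by rewrite as5.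
pose t8 := exec (Incr b) (exec (Copy b.+1 b.+2) t6).
have body : run (prec_body xs b) t4 t8.
  apply/run_seqs; exists t5 => //; exists t6 => //.
  by exists (exec (Copy b.+1 b.+2) t6) => //; exists t8.
exists t1, t2, t8; split=> //.
- exact: star_rcons r4 body.
- exact: prec_body_sound I4 body.
- rewrite /t8 /= !eqxx (ltn_eqF (ltnSn b)) (gtn_eqF (ltnSn b)) a6 ?a5 ?Et //; last by lia.
  by rewrite a6.
Qed.

End Prec.

(** * Checking minimisations *)

Section Mu.
Variables (n : nat) (f : recfun n.+1).

(** Register [b] holds the candidate and [b.+1] a guess of the value of [f] there; equality with the
    incremented guess in [b.+2] shows this value to be nonzero. *)
Definition mu_body (xs : n.-tuple nat) (b : nat) : prog :=
  seqs [:: havoc b.+1; check f [tuple of b :: xs] b.+1 b.+3;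
           havoc b.+2; Cmd (Incr b.+2); Cmd (Test b.+1 b.+2); Cmd (Incr b)].

Definition mu_inv (xs : n.-tuple nat) b s t :=
  agree b s t /\ forall u, (u < t b)%N ->
    exists z, computes f [tuple of u :: vals s xs] z.+1.

Lemma mu_body_sound xs b s t t' : check_sound f -> (0 < b)%N ->
  all_below b xs -> s 0%N = 0%N -> mu_inv xs b s t -> run (mu_body xs b) t t' ->
  mu_inv xs b s t'.
Proof.
move=> sf b0 xsb s0 [ast Pt] /run_seqs[t1 /havoc_except e1].
have at1 : agree b.+1 t t1 by apply: agree_except e1.
have as1 : agree b s t1 := agree_trans ast (agree_leq (leqnSn b) at1).
case=> t2 /sf[||||a2 c2].
- by [].
- by lia.
- by rewrite /all_below /=; apply/andP; split; [lia | apply: all_below_leq xsb; lia].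
- by rewrite as1.
case=> t3 /havoc_except e3 [_ [_ ->] [_ [/= /eqP E ->] [_ [_ ->] <-]]] {t'}.
have a3 : agree b.+2 t2 t3 by apply: agree_except e3.
have E1 : t1 b.+1 = (t3 b.+2).+1.
  by move: E; rewrite eqxx (ltn_eqF (ltnSn b.+1)) a3 // a2.
have a13 : agree b.+2 t1 t3 := agree_trans (agree_leq (leqnSn _) a2) a3.
split.
  move=> q qb /=; rewrite !ltn_eqF //; last by lia.
  by rewrite a13 ?as1 //; lia.
move=> u; rewrite /= eqxx ltn_eqF; last by lia.
rewrite a13 ?at1 //.
rewrite ltnS leq_eqVlt => /orP[/eqP ->|/Pt //].
exists (t3 b.+2); rewrite -E1; move: c2.
by rewrite vals_cons (vals_agree xsb as1) at1.
Qed.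

Lemma check_sound_mu : check_sound f -> check_sound (RMu f).
Proof.
move=> sf xs y b s s' b0 yb xsb s0 /run_seqs[t1 [_ t1E]].
have I1 : mu_inv xs b s t1.
  rewrite t1E; split=> [q qb|u] /=; first by rewrite ltn_eqF.
  by rewrite eqxx s0.
case=> t2 st2; change (star (run (mu_body xs b)) t1 t2) in st2.
have [a2 P2] : mu_inv xs b s t2.
  apply: star_invariant I1 st2 => u u'; exact: mu_body_sound.
case=> _ [/= /eqP Eb ->] [t3 [_ t3E]].
have a3 : agree b s t3.
  by move=> q qb; rewrite t3E /= ltn_eqF ?a2 //; lia.
case=> t4 r4 <-; case/sf: r4 => [||||a4 c4].
- by [].
- by lia.
- rewrite /all_below /=; apply/andP; split; first by lia.
  by apply: all_below_leq xsb; lia.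
- by rewrite a3.
split; first by apply: agree_trans a3 (agree_leq _ a4); lia.
split; last by move=> u; rewrite -(a2 _ yb) -Eb; apply: P2.
move: c4; rewrite vals_cons (vals_agree xsb a3) a3 //.
by rewrite t3E /= eqxx a2 // s0.
Qed.

Lemma check_complete_mu : check_sound f -> check_complete f -> check_complete (RMu f).
Proof.
move=> sf cf xs y b s b0 yb xsb s0 [c0 cS].
have xb3 r : (r < b.+3)%N -> all_below b.+3 [tuple of r :: xs].
  by move=> rb; rewrite /all_below /= rb; apply: all_below_leq xsb; lia.
have [t [st Et It]] : exists t, [/\ star (run (mu_body xs b)) (exec (Copy b 0) s) t,
    t b = s y & mu_inv xs b s t].
  (* Induction on the number of rounds, bounded by [s y] because [cS] speaks only of candidates
     below it. *)
  move: (leqnn (s y)); elim: {1 3}(s y) => [|v IH] vy.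
    exists (exec (Copy b 0) s); rewrite /= eqxx s0; split=> //.
      exact: star_refl.
    by split=> [q qb|u] /=; [rewrite ltn_eqF | rewrite eqxx].
  have [t [st Et It]] := IH (ltnW vy).
  have at_ := It.1; have t0 : t 0%N = 0%N by rewrite at_.
  have [z cz] := cS v vy.
  have [t1 r1 t1z] := havoc_value b.+1 z.+1 t0.
  have a1 : agree b.+1 t t1 by apply: agree_except (havoc_except r1).
  have as1 : agree b s t1 := agree_trans at_ (agree_leq (leqnSn b) a1).
  have [|||||t2 r2] := cf _ b.+1 b.+3 t1 _ _ (xb3 b _).
  - by [].
  - by lia.
  - by lia.
  - by rewrite as1.
  - by rewrite vals_cons (vals_agree xsb as1) a1 // Et t1z.
  have [||||a2 _] := sf _ _ _ _ _ _ _ (xb3 b _) _ r2.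
  - by [].
  - by lia.
  - by lia.
  - by rewrite as1.
  have t20 : t2 0%N = 0%N by rewrite a2 // as1.
  have [t3 r3 t3z] := havoc_value b.+2 z t20.
  have a3 : agree b.+2 t2 t3 by apply: agree_except (havoc_except r3).
  pose t4 := exec (Incr b.+2) t3; pose t5 := exec (Incr b) t4.
  have body : run (mu_body xs b) t t5.
    apply/run_seqs; exists t1 => //; exists t2 => //; exists t3 => //.
    exists t4 => //; exists t4; last by exists t5.
    by rewrite /t4 /= eqxx (ltn_eqF (ltnSn b.+1)) t3z a3 // a2 // t1z.
  exists t5; split; first exact: star_rcons st body.
    rewrite /t5 /t4 /= eqxx ltn_eqF; last by lia.
    by rewrite a3 ?a2 ?a1 ?Et //; lia.
  exact: mu_body_sound It body.
have a2 := It.1; pose t3 := exec (Copy b.+1 0) t.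
have a3 : agree b s t3.
  by move=> q qb; rewrite /t3 /= ltn_eqF ?a2 //; lia.
have [|||||t4 r4] := cf _ b.+1 b.+3 t3 _ _ (xb3 y _).
- by [].
- by lia.
- by lia.
- by rewrite a3.
- by rewrite vals_cons (vals_agree xsb a3) a3 // /t3 /= eqxx a2 // s0.
exists t4; apply/run_seqs; exists (exec (Copy b 0) s) => //; exists t => //.
exists t; first by rewrite /= Et a2.
by exists t3 => //; exists t4.
Qed.

End Mu.

Lemma check_correct n (f : recfun n) : check_sound f /\ check_complete f.
Proof.
elim: f => {n} [n||n i|n k f [sf cf] g IH|n f [sf cf] g [sg cg]|n f [sf cf]].
- split=> [xs y b s s' b0 yb xsb s0 [/= /eqP -> ->]|xs y b s b0 yb xsb s0 /= ->].
    by split.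
  by exists s; rewrite s0.
- split=> [xs y b s s' b0 yb xsb s0 /run_seqs|xs y b s b0 yb xsb s0 /=].
    case=> _ [_ ->] [_ [_ ->] [_ [/= /eqP E ->] <-]].
    split=> [q qb|]; first by rewrite !ltn_eqF.
    by move: E; rewrite (ltn_eqF yb) !eqxx => ->; rewrite vals_thead.
  rewrite vals_thead => E; exists (exec (Incr b) (exec (Copy b (thead xs)) s)).
  apply/(run_seqs [:: Cmd (Copy b (thead xs)); Cmd (Incr b); Cmd (Test y b)]).
  do 2![eexists; first by split].
  by eexists; first by split; rewrite //= (ltn_eqF yb) !eqxx E.
- split=> [xs y b s s' b0 yb xsb s0 [/= /eqP E ->]|xs y b s b0 yb xsb s0 /= E].
    by split; rewrite // tnth_map.
  by exists s; rewrite E tnth_map eqxx.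
- by split; [apply: check_sound_comp | apply: check_complete_comp] => // i;
    case: (IH i).
- by split; [apply: check_sound_prec | apply: check_complete_prec].
- by split; [apply: check_sound_mu | apply: check_complete_mu].
Qed.

Lemma computes_functional n (f : recfun n) v y z :
  computes f v y -> computes f v z -> y = z.
Proof.
elim: f v y z => {n} [n||n i|n k f IHf g IHg|n f IHf g IHg|n f IHf] v y z /=.
- by move=> -> ->.
- by move=> -> ->.
- by move=> -> ->.
- case=> u gu fu [u' gu' fu']; apply: IHf fu _.
  suff -> : u = u' by [].
  by apply: eq_from_tnth => i; apply: IHg (gu i) (gu' i).
- elim: (thead v) y z => [|t IH] y z; first exact: IHf.
  by case=> y' py' gy [z' /(IH _ _ py') <-]; apply: IHg.
case=> fy ny [fz nz]; have [yz|zy|//] := ltngtP y z.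
  by have [w fw] := nz _ yz; have := IHf _ _ _ fy fw.
by have [w fw] := ny _ zy; have := IHf _ _ _ fz fw.
Qed.

(** * Computing the code of an instance *)

Section Computable.

Definition computable n (F : n.-tuple nat -> nat) : Prop :=
  exists f : recfun n, forall v y, computes f v y <-> y = F v.

Definition computable1 (h : nat -> nat) : Prop :=
  computable (fun v : 1.-tuple nat => h (thead v)).
Definition computable2 (h : nat -> nat -> nat) : Prop :=
  computable (fun v : 2.-tuple nat => h (thead v) (thead [tuple of behead v])).

Lemma eq_computable n (F G : n.-tuple nat -> nat) :
  F =1 G -> computable F -> computable G.
Proof. by move=> FG [f fF]; exists f => v y; rewrite fF FG. Qed.

Lemma computable_proj n (i : 'I_n) : computable (fun v => tnth v i).
Proof. by exists (RProj i). Qed.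

Lemma computable_thead n : computable (fun v : n.+1.-tuple nat => thead v).
Proof. exact: computable_proj. Qed.

Lemma computable_comp n k (F : k.-tuple nat -> nat) (H : 'I_k -> n.-tuple nat -> nat) :
  computable F -> (forall i, computable (H i)) ->
  computable (fun v => F [tuple H i v | i < k]).
Proof.
move=> [f fF] /fin_all_exists[h hH]; exists (RComp f h) => v y /=.
split=> [[u hu /fF ->]|->].
  congr F; apply: eq_from_tnth => i; rewrite tnth_mktuple.
  exact/hH/hu.
exists [tuple H i v | i < k]; last exact/fF.
by move=> i; apply/hH; rewrite tnth_mktuple.
Qed.

Lemma computable_lift1 n h (F : n.-tuple nat -> nat) :
  computable1 h -> computable F -> computable (fun v => h (F v)).
Proof.
move=> hh cF; apply: eq_computable (computable_comp hh (fun=> cF)) => v.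
by rewrite /thead tnth_mktuple.
Qed.

Lemma computable_lift2 n h (F G : n.-tuple nat -> nat) :
  computable2 h -> computable F -> computable G ->
  computable (fun v => h (F v) (G v)).
Proof.
move=> hh cF cG.
pose H (i : 'I_2) := if i == 0 :> nat then F else G.
have cH i : computable (H i) by rewrite /H; case: ifP.
apply: eq_computable (computable_comp hh cH) => v.
by rewrite /thead tnth_behead !tnth_mktuple /H /= inordK.
Qed.

Lemma computable_const n c : computable (fun _ : n.-tuple nat => c).
Proof.
elim: c => [|c IH]; first by exists (RZero n).
by apply: (@computable_lift1 n S) IH; exists RSucc.
Qed.

Lemma computable_prec n (F : n.-tuple nat -> nat) (G : n.+2.-tuple nat -> nat)
    (H : n.+1.-tuple nat -> nat) :
  computable F -> computable G ->
  (forall x : n.-tuple nat, H [tuple of 0%N :: x] = F x) ->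
  (forall t (x : n.-tuple nat), H [tuple of t.+1 :: x] =
    G [tuple of t :: H [tuple of t :: x] :: x]) ->
  computable H.
Proof.
move=> [f fF] [g gG] H0 HS; exists (RPrec f g) => v y.
case/tupleP: v => t x; change (prec_rel f g [tuple of behead [tuple of t :: x]] t y
  <-> y = H [tuple of t :: x]).
have -> : [tuple of behead [tuple of t :: x]] = x by apply: val_inj.
elim: t y => [|t IH] y /=; first by rewrite fF H0.
rewrite HS -gG; split=> [[z /IH ->]//|gy].
by exists (H [tuple of t :: x]) => //; apply/IH.
Qed.

Lemma computable1_succ : computable1 S. Proof. by exists RSucc. Qed.

Lemma computable1_iter a (h : nat -> nat) :
  computable1 h -> computable1 (fun n => iter n h a).
Proof.
move=> ch; apply: computable_prec (computable_const 0 a) _ _ _.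
- exact: (computable_lift1 ch (computable_proj (inord 1 : 'I_2))).
- by [].
- by move=> t x; rewrite !theadE /= (tnth_nth 0%N) inordK.
Qed.

Lemma computable2_iter (h : nat -> nat) :
  computable1 h -> computable2 (fun n m => iter n h m).
Proof.
move=> ch; apply: computable_prec (computable_thead 0) _ _ _.
- exact: (computable_lift1 ch (computable_proj (inord 1 : 'I_3))).
- by case/tupleP.
- by move=> t x; rewrite /thead !(tnth_nth 0%N) /= inordK.
Qed.

Lemma computable1_double : computable1 double.
Proof.
apply: eq_computable (computable1_iter 0 (_ : computable1 (fun n => n.+2))).
  by move=> v; elim: (thead v) => //= n ->; rewrite doubleS.
exact: computable_lift1 computable1_succ computable1_succ.
Qed.

Lemma computable1_exp2 : computable1 (expn 2).
Proof.
apply: eq_computable (computable1_iter 1 computable1_double) => v.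
by elim: (thead v) => //= n ->; rewrite -mul2n expnS.
Qed.

Lemma computable2_add : computable2 addn.
Proof.
apply: eq_computable (computable2_iter computable1_succ) => v.
by elim: (thead v) => //= n ->.
Qed.

(** The step of the fold [CodeSeq.code], so consing on lists becomes this function on codes by
    conversion. *)
Definition code_cons (a m : nat) : nat := (2 ^ a * m.*2.+1)%N.

Lemma computable2_code_cons : computable2 code_cons.
Proof.
have cD := computable_proj (inord 1 : 'I_2).
apply: eq_computable (computable_lift2 (computable2_iter computable1_double)
  (computable_thead 1)
  (computable_lift1 computable1_succ (computable_lift1 computable1_double cD))) => v.
rewrite /code_cons (_ : tnth v _ = thead [tuple of behead v]); last first.
  by case/tupleP: v => a; case/tupleP=> b v; rewrite (tnth_nth 0%N) inordK.
elim: (thead v) => [|n IH]; first by rewrite mul1n.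
by rewrite iterS IH -mul2n mulnA expnS.
Qed.

Definition code_ratio (p q : nat) : nat := CodeSeq.code [:: p; q].

Lemma computable2_code_ratio : computable2 code_ratio.
Proof.
apply: (computable_lift2 computable2_code_cons (computable_thead 1)).
apply: (computable_lift2 computable2_code_cons _ (computable_const _ 0)).
by apply: eq_computable (computable_proj (inord 1 : 'I_2)) => v;
  case/tupleP: v => a; case/tupleP=> b v; rewrite (tnth_nth 0%N) inordK.
Qed.

End Computable.

Lemma code_rat_ratio p q : (0 < q)%N -> coprime p q ->
  code_rat (p%:R / q%:R) = code_ratio p q.
Proof.
move=> q0 cpq; have cpq' : coprime `|p%:Z| `|q%:Z| by [].
rewrite /code_rat !pmulrn (coprimeq_num cpq') (coprimeq_den cpq').
by rewrite gtr0_sg // mul1r; case: q q0 {cpq cpq'}.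
Qed.

(* [z] is the code of the list of zeros that follows the three initial weights. *)
Definition code_initial (z n : nat) : nat :=
  code_cons (code_ratio (2 ^ n) (norm n)) (code_cons (code_ratio 1 (norm n))
    (code_cons (code_ratio (2 ^ n.*2) (norm n)) z)).

(** The layout of [code_instance]: [v] holds the three sizes, the code of the chain, the code of the
    trailing zeros and the code of the moves of the MDP. *)
Definition plug (v : 6.-tuple nat) (n : nat) : nat :=
  let x i := nth 0%N v i in
  CodeSeq.code [:: x 0; x 1; x 2; x 3;
    CodeSeq.code [:: code_initial (x 4) n; x 5]]%N.

Lemma computable1_norm : computable1 norm.
Proof.
apply: (eq_computable (F := fun v : 1.-tuple nat =>
    (2 ^ (thead v).*2 + 2 ^ thead v).+1)).
  by move=> v; rewrite /norm addn1 -expnM muln2.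
apply: (computable_lift1 computable1_succ).
apply: (computable_lift2 computable2_add) (computable1_exp2).
exact: computable_lift1 computable1_exp2 computable1_double.
Qed.

Lemma computable2_code_initial : computable2 code_initial.
Proof.
have cn : computable (fun v : 2.-tuple nat => thead [tuple of behead v]).
  by apply: eq_computable (computable_proj (inord 1 : 'I_2)) => v;
    case/tupleP: v => a; case/tupleP=> b v; rewrite (tnth_nth 0%N) inordK.
have cN := computable_lift1 computable1_norm cn.
have cc := computable2_code_cons; have cr := computable2_code_ratio.
apply: (computable_lift2 cc).
  exact: computable_lift2 cr (computable_lift1 computable1_exp2 cn) cN.
apply: (computable_lift2 cc); first exact: computable_lift2 cr (computable_const _ _) cN.
apply: (computable_lift2 cc) (computable_thead _).
apply: (computable_lift2 cr) cN; apply: (computable_lift1 computable1_exp2).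
exact: computable_lift1 computable1_double cn.
Qed.

Lemma computable_nth n i : computable (fun v : n.-tuple nat => nth 0%N v i).
Proof.
have [lt_in|le_ni] := ltnP i n.
  by apply: eq_computable (computable_proj (Ordinal lt_in)) => v; rewrite (tnth_nth 0%N).
apply: eq_computable (computable_const n 0) => v.
by rewrite nth_default ?size_tuple.
Qed.

Lemma computable_code n : computable (fun v : n.-tuple nat => CodeSeq.code v).
Proof.
apply: (eq_computable (F := fun v : n.-tuple nat =>
    CodeSeq.code [seq nth 0%N v i | i <- iota 0 n])).
  by move=> v; rewrite map_nth_iota0 ?size_tuple // -{1}(size_tuple v) take_size.
elim: (iota 0 n) => [|i js IH]; first exact: computable_const.
exact: computable_lift2 computable2_code_cons (computable_nth _ i) IH.
Qed.

(** This is the diagonal function: the description [v] receives its own code as input. *)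
Lemma computable_plug : computable (fun v => plug v (CodeSeq.code v)).
Proof.
have cc := computable2_code_cons.
do 4![apply: (computable_lift2 cc); first exact: computable_nth].
apply: (computable_lift2 cc) (computable_const _ 0).
apply: (computable_lift2 cc).
  apply: (computable_lift2 computable2_code_initial); first exact: computable_nth.
  exact: computable_code.
apply: (computable_lift2 cc) (computable_const _ 0).
exact: computable_nth.
Qed.

(** [norm n] is one more than a multiple of [2 ^ n]. *)
Lemma coprime_norm a n : (a = 2 ^ n \/ a = 1 \/ a = (2 ^ n) ^ 2)%N ->
  coprime a (norm n).
Proof.
have cN : coprime (2 ^ n) (norm n).
  by rewrite /norm -mulnn -mulSnr /coprime gcdnMDl gcdn1.
by move=> [->|[->|->]] //; [apply: coprime1n | apply: coprimeXl].
Qed.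

Lemma code_initialE (N : finType) k' n :
  code_init (initial N k' n) =
  code_initial (CodeSeq.code
    (nseq #|{: 'I_3 + (N + 'I_k'.+2 * 'I_k'.+2)}| (code_rat 0))) n.
Proof.
rewrite /code_init; set m := #|_|.
have -> : [seq code_rat (initial N k' n q) | q <- enum 'I_(3 + m)] =
    [seq code_rat (initial_weights n)`_i | i <- iota 0 (3 + m)].
  by rewrite -val_enum_ord -map_comp; apply: eq_map => q; rewrite /= ffunE.
have norm0 : (0 < norm n)%N by rewrite /norm addn1.
rewrite /= !code_rat_ratio ?coprime_norm; auto.
have -> : [seq code_rat (initial_weights n)`_i | i <- iota 3 m] = nseq m (code_rat 0).
  apply: (@eq_from_nth _ 0%N) => [|i]; rewrite size_map size_iota ?size_nseq // => im.
  by rewrite (nth_map 0%N) ?size_iota // nth_nseq im nth_iota // [_`_(_ + _)]nth_default.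
by rewrite /code_initial -expnM muln2.
Qed.

(** One [v] serves all [n], because [n] enters only the initial distribution; the moves are those of
    [D 0]. *)
Lemma code_program_instance (N : finType) (E : seq (N * cmd * N))
    (start final bad : N) (k' : nat) : exists v : 6.-tuple nat, forall n,
  code_instance (program_instance E start final bad k' n) = plug v n.
Proof.
pose D := program_mdp E start final bad k'.
pose m := #|{: 'I_3 + (N + 'I_k'.+2 * 'I_k'.+2)}|.
exists [tuple 3 + size E; 1; 3 + m; code_mdp (uniform_mc (label_x E));
  CodeSeq.code (nseq m (code_rat 0));
  CodeSeq.code [seq CodeSeq.code [seq code_move c | c <- moves (D 0%N) q]
               | q <- enum 'I_(3 + m)]]%N.
by move=> n; rewrite /code_instance /code_mdp /= code_initialE.
Qed.

(* The program guesses [v], checks its guess against register [1], and then checks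
   the computation of [f]. *)
Lemma self_reference (f : recfun 1) : exists p, forall v : 6.-tuple nat,
  (exists s, run p (input_regs (CodeSeq.code v)) s) <->
  computes f [tuple plug v (CodeSeq.code v)] 1%N.
Proof.
have [enc encE] := computable_code 6; have [plg plgE] := computable_plug.
(* Register 1 holds the input, 2 to 7 the guess of [v], 8 the plugged code and 9 the constant 1;
   scratch registers start at 11. *)
pose args := [tuple (2 + i)%N | i < 6].
exists (seqs ([seq havoc r | r <- iota 2 8] ++
  [:: check enc args 1 11; check plg args 8 11;
      Cmd (Copy 9 0); Cmd (Incr 9); check f [tuple 8] 9 11]))%N.
move=> v; set s0 := input_regs _.
have argsb : all_below 11 args.
  by apply/all_tnthP => i; rewrite tnth_mktuple; case: i => i /=; lia.
have [[se ce] [sp cp] [sf cf]] :=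
  And3 (check_correct enc) (check_correct plg) (check_correct f).
split.
  case=> s /run_seqs/run_seq_cat[s1 /guess_frame fr].
  have s10 : s1 0%N = 0%N by rewrite fr.
  have s11 : s1 1%N = CodeSeq.code v by rewrite fr.
  case=> s2 /(se args 1%N 11%N _ _ isT isT argsb s10)[a2 /encE].
  (* [CodeSeq.code] is injective, so a guess with the right code is [v]. *)
  rewrite s11 => Ev; have {}Ev : vals s1 args = v.
    exact/val_inj/esym/(can_inj CodeSeq.codeK).
  have s20 : s2 0%N = 0%N by rewrite a2.
  case=> s3 /(sp args 8%N 11%N _ _ isT isT argsb s20)[a3 /plgE].
  rewrite (vals_agree argsb a2) Ev a2 // => E8.
  case=> _ [_ ->] [_ [_ ->] [s4 r4 _]].
  have s30 : exec (Incr 9) (exec (Copy 9 0) s3) 0%N = 0%N by rewrite /= a3.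
  have [_] := sf [tuple 8%N] 9%N 11%N _ _ isT isT isT s30 r4.
  rewrite [exec _ _ 9%N]/= a3 // s20 (_ : vals _ _ = [tuple plug v (CodeSeq.code v)]) //.
  by apply: val_inj; rewrite /= a3 // a2 // E8.
move=> cfp; pose F r := if r == 8%N then plug v (CodeSeq.code v) else nth 0%N v (r - 2).
have [|//|s1 r1 s1F] := @guess_value (iota 2 8) s0 F.
  by [].
have fr := guess_frame r1.
have s10 : s1 0%N = 0%N by rewrite fr.
have Ev : vals s1 args = v.
  apply: eq_from_tnth => i; rewrite tnth_map tnth_mktuple s1F; last first.
    by rewrite mem_iota; case: i => i /=; lia.
  rewrite /F (tnth_nth 0%N) addKn.
  by case: i => [[|[|[|[|[|[|]]]]]]].
have [|s2 r2] := ce args 1%N 11%N s1 isT isT argsb s10.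
  by apply/encE; rewrite Ev fr.
have [a2 _] := se args 1%N 11%N _ _ isT isT argsb s10 r2.
have s20 : s2 0%N = 0%N by rewrite a2.
have [|s3 r3] := cp args 8%N 11%N s2 isT isT argsb s20.
  by apply/plgE; rewrite (vals_agree argsb a2) Ev a2 // s1F.
have [a3 _] := sp args 8%N 11%N _ _ isT isT argsb s20 r3.
pose s4 := exec (Incr 9) (exec (Copy 9 0) s3).
have s40 : s4 0%N = 0%N by rewrite /s4 /= a3.
have [|s5 r5] := cf [tuple 8%N] 9%N 11%N s4 isT isT isT s40.
  rewrite (_ : vals _ _ = [tuple plug v (CodeSeq.code v)]).
    by rewrite /s4 /= a3 // s20.
  by apply: val_inj; rewrite /s4 /= a3 // a2 // s1F.
exists s5; apply/run_seqs/run_seq_cat; exists s1 => //.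
exists s2 => //; exists s3 => //; exists (exec (Copy 9 0) s3) => //.
by exists s4 => //; exists s5.
Qed.

Theorem theorem1 (R : realType) :
  ~ recursively_decidable code_instance (MC_refines_MDP R).
Proof.
case=> f fP; have [p pP] := self_reference f.
pose x := program_instance (control_edges p) (node_of p [:: p]) (node_of p [::])
  ord_max (max_reg p).
have [v vP] : exists v : 6.-tuple nat, forall n, code_instance (x n) = plug v n.
  exact: code_program_instance.
(* With this input the plugged code computed by the program is the code of [y] itself. *)
pose y := x (CodeSeq.code v).
have yP : MC_refines_MDP R y <-> ~ computes f [tuple code_instance y] 1%N.
  rewrite vP -pP -control_correct; apply: program_instanceP.
  exact: control_edges_below.
have [f1 f0] := fP y.
(* If [y] were positive, [f] would answer 1, which makes [y] negative. So [f] answers 0, hence not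
   1, which makes [y] positive. *)
have ny : ~ MC_refines_MDP R y by move=> Py; apply: (yP.1 Py); apply: f1.
apply: (ny); apply/yP => f1y.
by have := computes_functional f1y (f0 ny).
Qed.
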